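(* Let $\mathcal{C}$ and $\mathcal{D}$ be abelian categories with enough projective objects and enough injective objects, let $\mathsf{G}:\mathcal{C}\to\mathcal{D}$ be an additive right exact functor, and let $(\mathsf{G}\downarrow\mathcal{D})$ be the comma category. Let $(\mathcal{U},\mathcal{X})$ and $(\mathcal{V},\mathcal{Y})$ be hereditary complete cotorsion pairs in $\mathcal{C}$ and $\mathcal{D}$, respectively. If $\mathbb{L}_1\mathsf{G}(U)=0$ for all $U\in\mathcal{U}$ and $\mathsf{G}(\mathcal{U})\subseteq\mathcal{Y}$, then the following hold. (1) $\big({}^{\perp}\left(\begin{smallmatrix}\mathcal{X}\\ \mathcal{Y}\end{smallmatrix}\right),\left(\begin{smallmatrix}\mathcal{X}\\ \mathcal{Y}\end{smallmatrix}\right)\big)$ is a hereditary complete cotorsion pair in $(\mathsf{G}\downarrow\mathcal{D})$. (2) ${}^{\perp}\left(\begin{smallmatrix}\mathcal{X}\\ \mathcal{Y}\end{smallmatrix}\right)=\left\{\left(\begin{smallmatrix}U\\ \mathsf{G}(U)\end{smallmatrix}\right)_{1}\oplus\left(\begin{smallmatrix}0\\ V\end{smallmatrix}\right)_{0}\ :\ U\in\mathcal{U},\ V\in\mathcal{V}\right\}$ (up to isomorphism). (3) If $\omega_1=\mathcal{U}\cap\mathcal{X}$ and $\omega_2=\mathcal{V}\cap\mathcal{Y}$ are contravariantly finite in $\mathcal{C}$ and $\mathcal{D}$ respectively, then $$\omega={}^{\perp}\left(\begin{smallmatrix}\mathcal{X}\\ \mathcal{Y}\end{smallmatrix}\right)\cap\left(\begin{smallmatrix}\mathcal{X}\\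 \mathcal{Y}\end{smallmatrix}\right)=\left\{\left(\begin{smallmatrix}U\\ \mathsf{G}(U)\end{smallmatrix}\right)_{1}\oplus\left(\begin{smallmatrix}0\\ V\end{smallmatrix}\right)_{0}\ :\ U\in\mathcal{U}\cap\mathcal{X},\ V\in\mathcal{V}\cap\mathcal{Y}\right\}$$ (up to isomorphism) is contravariantly finite in $(\mathsf{G}\downarrow\mathcal{D})$, and there is an equivalence of categories $\mathrm{Ho}(\mathcal{M}_\omega)\simeq\mathrm{Ho}(\mathcal{M}_{\omega_1})\times\mathrm{Ho}(\mathcal{M}_{\omega_2})$.
   Context: The comma category $(\mathsf{G}\downarrow\mathcal{D})$ has objects $\left(\begin{smallmatrix}X\\ Y\end{smallmatrix}\right)_f$ with $X\in\mathcal{C}$, $Y\in\mathcal{D}$ and $f:\mathsf{G}(X)\to Y$ in $\mathcal{D}$; a morphism $\left(\begin{smallmatrix}X\\ Y\end{smallmatrix}\right)_f\to\left(\begin{smallmatrix}X'\\ Y'\end{smallmatrix}\right)_{f'}$ is a pair $(\alpha,\beta)$ with $\alpha:X\to X'$, $\beta:Y\to Y'$ and $f'\circ\mathsf{G}(\alpha)=\beta\circ f$. It is an abelian category with enough projectives, with exactness computed componentwise. $\left(\begin{smallmatrix}\mathcal{X}\\ \mathcal{Y}\end{smallmatrix}\right)=\{\left(\begin{smallmatrix}X\\ Y\end{smallmatrix}\right)_f : X\in\mathcal{X},\,Y\in\mathcal{Y}\}$. $\mathbb{L}_1\mathsf{G}$ is the first left derived functor of $\mathsf{G}$. For a class $\mathcal{S}$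 of objects in an abelian category $\mathcal{A}$: ${}^{\perp}\mathcal{S}=\{Y : \mathrm{Ext}^1_{\mathcal{A}}(Y,S)=0\ \forall S\in\mathcal{S}\}$, $\mathcal{S}^{\perp}=\{Y : \mathrm{Ext}^1_{\mathcal{A}}(S,Y)=0\ \forall S\in\mathcal{S}\}$. A pair $(\mathcal{L},\mathcal{R})$ is a cotorsion pair if $\mathcal{L}={}^{\perp}\mathcal{R}$ and $\mathcal{R}=\mathcal{L}^{\perp}$; it is complete if for every object $A$ there are exact sequences $0\to R\to L\to A\to0$ and $0\to A\to R'\to L'\to0$ with $L,L'\in\mathcal{L}$, $R,R'\in\mathcal{R}$; it is hereditary if $\mathrm{Ext}^i_{\mathcal{A}}(L,R)=0$ for all $i\ge1$, $L\in\mathcal{L}$, $R\in\mathcal{R}$. A class $\omega$ is contravariantly finite in $\mathcal{A}$ if for every object $A$ there is a morphism $X_A\to A$ with $X_A\in\omega$ through which every morphism $X\to A$ with $X\in\omega$ factors. For a hereditary complete cotorsion pair $(\mathcal{L},\mathcal{R})$ in $\mathcal{A}$ with $\omega=\mathcal{L}\cap\mathcal{R}$ contravariantly finite, $\mathcal{M}_\omega=(\mathrm{CoFib}_\omega,\mathrm{Fib}_\omega,\mathrm{Weq}_\omega)$ is the associated model structure on $\mathcal{A}$ (Beligiannis–Reiten): $\mathrm{CoFib}_\omega$ consists of the monomorphisms with cokernel in $\mathcal{L}$; $\mathrm{Fib}_\omega$ of the morphisms $f$ with $\mathrm{Hom}_{\mathcal{A}}(W,f)$ surjective for all $W\in\omega$;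 $\mathrm{Weq}_\omega$ of the composites $p\circ i$ with $i$ a split monomorphism with $\mathrm{Coker}(i)\in\omega$ and $p$ an epimorphism with $\mathrm{Ker}(p)\in\mathcal{R}$. $\mathrm{Ho}(\mathcal{M}_\omega)=\mathcal{A}[\mathrm{Weq}_\omega^{-1}]$, which is known to be equivalent to the additive quotient $\mathcal{L}/\omega$. *)

(* Defs.v *)
From HB Require Import structures.
From mathcomp Require Import all_boot ssralg.
From mathcomp Require Import generic_quotient ring_quotient boolp.
Set Implicit Arguments.
Unset Strict Implicit.
Unset Printing Implicit Defensive.
Import GRing.Theory.
Local Open Scope ring_scope.
Local Open Scope quotient_scope.

#[local] Obligation Tactic := idtac.

Declare Scope cat_scope.
Delimit Scope cat_scope with cat.
Local Open Scope cat_scope.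

Record category := Category {
  cob :> Type;
  chom : cob -> cob -> Type;
  cid : forall X, chom X X;
  ccomp : forall X Y Z, chom Y Z -> chom X Y -> chom X Z;
  ccompA : forall W X Y Z (h : chom Y Z) (g : chom X Y) (f : chom W X),
    ccomp h (ccomp g f) = ccomp (ccomp h g) f;
  ccomp1l : forall X Y (f : chom X Y), ccomp (cid Y) f = f;
  ccomp1r : forall X Y (f : chom X Y), ccomp f (cid X) = f }.

Record functor (A B : category) := Functor {
  fob :> A -> B;
  fmap : forall X Y, chom X Y -> chom (fob X) (fob Y);
  fmap1 : forall X, fmap (cid X) = cid (fob X);
  fmapM : forall X Y Z (g : chom Y Z) (f : chom X Y),
    fmap (ccomp g f) = ccomp (fmap g) (fmap f) }.

Definition functor_id (A : category) : functor A A :=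
  @Functor A A id (fun X Y f => f) (fun X => erefl) (fun X Y Z g f => erefl).

Program Definition functor_comp (A B C : category)
    (G : functor B C) (F : functor A B) : functor A C :=
  @Functor A C (fun X => G (F X)) (fun X Y f => fmap G (fmap F f)) _ _.
Next Obligation. by move=> A B C G F X; rewrite /= !fmap1. Qed.
Next Obligation. by move=> A B C G F X Y Z g f; rewrite /= !fmapM. Qed.

Definition natural_iso (A B : category) (F G : functor A B) : Prop :=
  exists (t : forall X, chom (F X) (G X)) (s : forall X, chom (G X) (F X)),
    (forall X Y (f : chom X Y),
       ccomp (fmap G f) (t X) = ccomp (t Y) (fmap F f)) /\
    (forall X, ccomp (s X) (t X) = cid (F X)) /\
    (forall X, ccomp (t X) (s X) = cid (G X)).

Definition equivalent_categories (A B : category) : Prop :=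
  exists (F : functor A B) (G : functor B A),
    natural_iso (functor_comp G F) (functor_id A) /\
    natural_iso (functor_comp F G) (functor_id B).

Program Definition prod_category (A B : category) : category :=
  @Category (A * B)%type
    (fun X Y => (chom X.1 Y.1 * chom X.2 Y.2)%type)
    (fun X => (cid X.1, cid X.2))
    (fun X Y Z g f => (ccomp g.1 f.1, ccomp g.2 f.2)) _ _ _.
Next Obligation. by move=> A B W X Y Z h g f; rewrite /= !ccompA. Qed.
Next Obligation. by move=> A B X Y [f g]; rewrite /= !ccomp1l. Qed.
Next Obligation. by move=> A B X Y [f g]; rewrite /= !ccomp1r. Qed.

(* A[W^-1], by generators and relations: same objects as A; a morphism is a
   formal composite of morphisms of A and of formal inverses of elements of W,
   modulo the smallest congruence making the result a category, [loc_of] a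
   functor and [loc_inv] a two-sided inverse. *)
Section Localization.
Variables (A : category) (W : forall X Y : A, chom X Y -> Prop).

Inductive loc_term : A -> A -> Type :=
| loc_of X Y (f : chom X Y) : loc_term X Y
| loc_inv X Y (w : chom X Y) (_ : W w) : loc_term Y X
| loc_comp X Y Z (t : loc_term Y Z) (s : loc_term X Y) : loc_term X Z.

Inductive loc_eq : forall X Y, loc_term X Y -> loc_term X Y -> Prop :=
| loc_refl X Y (t : loc_term X Y) : loc_eq t t
| loc_sym X Y (t s : loc_term X Y) : loc_eq t s -> loc_eq s t
| loc_trans X Y (t s r : loc_term X Y) :
    loc_eq t s -> loc_eq s r -> loc_eq t r
| loc_congr X Y Z (t t' : loc_term Y Z) (s s' : loc_term X Y) :
    loc_eq t t' -> loc_eq s s' -> loc_eq (loc_comp t s) (loc_comp t' s')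
| loc_assoc X1 X2 X3 X4 (t : loc_term X3 X4) (s : loc_term X2 X3)
    (r : loc_term X1 X2) :
    loc_eq (loc_comp t (loc_comp s r)) (loc_comp (loc_comp t s) r)
| loc_id_l X Y (t : loc_term X Y) : loc_eq (loc_comp (loc_of (cid Y)) t) t
| loc_id_r X Y (t : loc_term X Y) : loc_eq (loc_comp t (loc_of (cid X))) t
| loc_ofM X Y Z (g : chom Y Z) (f : chom X Y) :
    loc_eq (loc_of (ccomp g f)) (loc_comp (loc_of g) (loc_of f))
| loc_invK X Y (w : chom X Y) (hw : W w) :
    loc_eq (loc_comp (loc_inv hw) (loc_of w)) (loc_of (cid X))
| loc_invVK X Y (w : chom X Y) (hw : W w) :
    loc_eq (loc_comp (loc_of w) (loc_inv hw)) (loc_of (cid Y)).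

HB.instance Definition _ X Y := gen_eqMixin (loc_term X Y).
HB.instance Definition _ X Y := gen_choiceMixin (loc_term X Y).

Definition loc_eqb X Y (t s : loc_term X Y) : bool := `[< loc_eq t s >].

Lemma loc_eqb_equiv X Y : equiv_class_of (@loc_eqb X Y).
Proof.
split=> [t|t s|s t r].
- exact/asboolP/loc_refl.
- by apply/asboolP/asboolP; exact: loc_sym.
- by move=> /asboolP ts /asboolP sr; apply/asboolP; exact: loc_trans ts sr.
Qed.

Canonical loc_equiv X Y := EquivRelPack (loc_eqb_equiv X Y).

Definition loc_hom (X Y : A) : Type := {eq_quot (loc_equiv X Y)}.
Definition loc_pi X Y (t : loc_term X Y) : loc_hom X Y :=
  \pi_({eq_quot (loc_equiv X Y)}) t.

Lemma loc_piP X Y (t s : loc_term X Y) : loc_pi t = loc_pi s <-> loc_eq t s.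
Proof.
split=> [/eqquotP/asboolP //|ts]; exact/eqquotP/asboolP.
Qed.

Lemma loc_piE X Y (u : loc_hom X Y) : exists t, u = loc_pi t.
Proof. by exists (repr u); rewrite /loc_pi reprK. Qed.

Definition loc_hcomp X Y Z (u : loc_hom Y Z) (v : loc_hom X Y) : loc_hom X Z :=
  loc_pi (loc_comp (repr u) (repr v)).

Lemma loc_hcompE X Y Z (t : loc_term Y Z) (s : loc_term X Y) :
  loc_hcomp (loc_pi t) (loc_pi s) = loc_pi (loc_comp t s).
Proof.
apply/loc_piP; apply: loc_congr; apply/loc_piP; exact: reprK.
Qed.

Program Definition localization : category :=
  @Category A loc_hom (fun X => loc_pi (loc_of (cid X))) loc_hcomp _ _ _.
Next Obligation.
move=> X1 X2 X3 X4 h g f; have [t ->] := loc_piE h; have [s ->] := loc_piE g.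
have [r ->] := loc_piE f; rewrite !loc_hcompE; exact/loc_piP/loc_assoc.
Qed.
Next Obligation.
move=> X Y f; have [t ->] := loc_piE f; rewrite loc_hcompE.
exact/loc_piP/loc_id_l.
Qed.
Next Obligation.
move=> X Y f; have [t ->] := loc_piE f; rewrite loc_hcompE.
exact/loc_piP/loc_id_r.
Qed.

End Localization.

(* Since [zmodType] includes decidable equality and choice, which every type has
   classically, hom-groups are arbitrary abelian groups. *)
Record preadditive := Preadditive {
  ob :> Type;
  hom : ob -> ob -> zmodType;
  idm : forall X, hom X X;
  comp : forall X Y Z, hom Y Z -> hom X Y -> hom X Z;
  compA : forall W X Y Z (h : hom Y Z) (g : hom X Y) (f : hom W X),
    comp h (comp g f) = comp (comp h g) f;
  comp1l : forall X Y (f : hom X Y), comp (idm Y) f = f;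
  comp1r : forall X Y (f : hom X Y), comp f (idm X) = f;
  compDl : forall X Y Z (g g' : hom Y Z) (f : hom X Y),
    comp (g + g') f = comp g f + comp g' f;
  compDr : forall X Y Z (g : hom Y Z) (f f' : hom X Y),
    comp g (f + f') = comp g f + comp g f' }.

Notation "g ∘ f" := (comp g f) (at level 40, left associativity) : cat_scope.

Definition cat_of (A : preadditive) : category :=
  @Category A (fun X Y => hom X Y) (@idm A) (@comp A)
    (@compA A) (@comp1l A) (@comp1r A).

Section PreadditiveTheory.
Variable A : preadditive.

Lemma comp0l (X Y Z : A) (f : hom X Y) : (0 : hom Y Z) ∘ f = 0.
Proof. by apply: (addrI (0 ∘ f)); rewrite -compDl !addr0. Qed.

Lemma comp0r (X Y Z : A) (g : hom Y Z) : g ∘ (0 : hom X Y) = 0.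
Proof. by apply: (addrI (g ∘ 0)); rewrite -compDr !addr0. Qed.

Lemma compNl (X Y Z : A) (g : hom Y Z) (f : hom X Y) : (- g) ∘ f = - (g ∘ f).
Proof. by apply: (addrI (g ∘ f)); rewrite -compDl !subrr comp0l. Qed.

Lemma compNr (X Y Z : A) (g : hom Y Z) (f : hom X Y) : g ∘ (- f) = - (g ∘ f).
Proof. by apply: (addrI (g ∘ f)); rewrite -compDr !subrr comp0r. Qed.

Definition is_zero (O : A) : Prop :=
  forall X : A, (forall f : hom O X, f = 0) /\ (forall f : hom X O, f = 0).

Definition mono (X Y : A) (f : hom X Y) : Prop :=
  forall (T : A) (g h : hom T X), f ∘ g = f ∘ h -> g = h.

Definition epi (X Y : A) (f : hom X Y) : Prop :=
  forall (T : A) (g h : hom Y T), g ∘ f = h ∘ f -> g = h.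

Definition split_mono (X Y : A) (i : hom X Y) : Prop :=
  exists r : hom Y X, r ∘ i = idm X.

Definition is_kernel (X Y K : A) (f : hom X Y) (k : hom K X) : Prop :=
  f ∘ k = 0 /\
  forall (T : A) (g : hom T X), f ∘ g = 0 -> exists! h : hom T K, k ∘ h = g.

Definition is_cokernel (X Y Q : A) (f : hom X Y) (c : hom Y Q) : Prop :=
  c ∘ f = 0 /\
  forall (T : A) (g : hom Y T), g ∘ f = 0 -> exists! h : hom Q T, h ∘ c = g.

(* [B] is, up to isomorphism, the direct sum of [X] and [Y]. *)
Definition is_direct_sum (X Y B : A) : Prop :=
  exists (i1 : hom X B) (i2 : hom Y B) (p1 : hom B X) (p2 : hom B Y),
    [/\ p1 ∘ i1 = idm X, p2 ∘ i2 = idm Y, p1 ∘ i2 = 0, p2 ∘ i1 = 0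
      & i1 ∘ p1 + i2 ∘ p2 = idm B].

Definition abelian : Prop :=
  [/\ exists O : A, is_zero O,
      forall X Y : A, exists B : A, is_direct_sum X Y B,
      forall (X Y : A) (f : hom X Y),
        (exists (K : A) (k : hom K X), is_kernel f k) /\
        (exists (Q : A) (c : hom Y Q), is_cokernel f c),
      forall (X Y : A) (f : hom X Y), mono f ->
        exists (Z : A) (g : hom Y Z), is_kernel g f
    & forall (X Y : A) (f : hom X Y), epi f ->
        exists (Z : A) (g : hom Z X), is_cokernel g f].

(* The image of [f] is the kernel of [g]. *)
Definition exact (X Y Z : A) (f : hom X Y) (g : hom Y Z) : Prop :=
  exists (K : A) (k : hom K Y) (e : hom X K),
    [/\ is_kernel g k, epi e & k ∘ e = f].

Definition short_exact (X Y Z : A) (f : hom X Y) (g : hom Y Z) : Prop :=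
  [/\ mono f, exact f g & epi g].

(* [H] is the homology at [Y] of the complex [X -f-> Y -g-> Z], i.e. the
   cokernel of the map from [X] to the kernel of [g]. *)
Definition is_homology (X Y Z : A) (f : hom X Y) (g : hom Y Z) (H : A) : Prop :=
  exists (K : A) (k : hom K Y) (e : hom X K) (c : hom K H),
    [/\ is_kernel g k, k ∘ e = f & is_cokernel e c].

Definition projective (P : A) : Prop :=
  forall (X Y : A) (e : hom X Y) (f : hom P Y), epi e ->
    exists g : hom P X, e ∘ g = f.

Definition injective_ob (I : A) : Prop :=
  forall (X Y : A) (m : hom X Y) (f : hom X I), mono m ->
    exists g : hom Y I, g ∘ m = f.

Definition enough_projectives : Prop :=
  forall X : A, exists (P : A) (e : hom P X), projective P /\ epi e.

Definition enough_injectives : Prop :=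
  forall X : A, exists (I : A) (m : hom X I), injective_ob I /\ mono m.

Record proj_resolution (X : A) := ProjResolution {
  res_ob : nat -> A;
  res_d : forall n, hom (res_ob n.+1) (res_ob n);
  res_aug : hom (res_ob 0) X;
  res_projective : forall n, projective (res_ob n);
  res_aug_epi : epi res_aug;
  res_exact0 : exact (res_d 0) res_aug;
  res_exact : forall n, exact (res_d n.+1) (res_d n) }.

Section Ext.
Variables (X : A) (P : proj_resolution X) (Y : A) (n : nat).

Definition cocycle_pred : pred (hom (res_ob P n) Y) :=
  fun f => f ∘ res_d P n == 0.

Lemma cocycle_zmod_closed : zmod_closed cocycle_pred.
Proof.
split=> [|f g]; rewrite /cocycle_pred !unfold_in ?comp0l // => /eqP f0 /eqP g0.
by rewrite compDl compNl f0 g0 subrr.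
Qed.

HB.instance Definition _ :=
  GRing.isZmodClosed.Build _ cocycle_pred cocycle_zmod_closed.

Record cocycle := Cocycle {
  cocycle_val :> hom (res_ob P n) Y;
  cocycle_valP : cocycle_val \in cocycle_pred }.

HB.instance Definition _ := [isSub for cocycle_val].
HB.instance Definition _ := [Choice of cocycle by <:].
HB.instance Definition _ := [SubChoice_isSubZmodule of cocycle by <:].

Lemma cocycle_val0 : cocycle_val 0 = 0.
Proof. exact: (raddf0 (val : cocycle -> _)). Qed.

Lemma cocycle_valB (f g : cocycle) :
  cocycle_val (f - g) = cocycle_val f - cocycle_val g.
Proof. exact: (raddfB (val : cocycle -> _)). Qed.

End Ext.

Definition is_coboundary (X : A) (P : proj_resolution X) (Y : A) (n : nat) :
    hom (res_ob P n) Y -> Prop :=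
  match n with
  | 0 => fun f => f = 0
  | m.+1 => fun f => exists g : hom (res_ob P m) Y, f = g ∘ res_d P m
  end.

Definition coboundary_pred (X : A) (P : proj_resolution X) (Y : A) (n : nat) :
    pred (cocycle P Y n) :=
  fun f => `[< is_coboundary (cocycle_val f) >].

Lemma coboundary_zmod_closed (X : A) (P : proj_resolution X) (Y : A) (n : nat) :
  zmod_closed (@coboundary_pred X P Y n).
Proof.
split=> [|f g]; rewrite !unfold_in.
  apply/asboolP; rewrite cocycle_val0.
  by case: n => [//|m]; exists 0; rewrite comp0l.
move=> /asboolP hf /asboolP hg; apply/asboolP.
rewrite cocycle_valB; move: hf hg; case: n f g => [|m] f g /=.
  by move=> -> ->; rewrite subrr.
by move=> [a ->] [b ->]; exists (a - b); rewrite compDl compNl.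
Qed.

HB.instance Definition _ X P Y n :=
  GRing.isZmodClosed.Build _ (@coboundary_pred X P Y n)
    (@coboundary_zmod_closed X P Y n).

(* Ext^n(X, Y) is the n-th cohomology group of the complex Hom(P, Y), for a
   projective resolution [P] of [X]. *)
Definition Ext (X : A) (P : proj_resolution X) (Y : A) (n : nat) : zmodType :=
  @Quotient.quot (cocycle P Y n)
    (GRing.ZmodClosed.clone _ (@coboundary_pred X P Y n) _).

(* Ext^n(X, Y) = 0.  The groups attached to two projective resolutions of [X]
   are isomorphic, so that nothing depends on the choice of [P]. *)
Definition Ext_zero (n : nat) (X Y : A) : Prop :=
  forall (P : proj_resolution X) (e : Ext P Y n), e = 0.

Definition left_perp (S : A -> Prop) : A -> Prop :=
  fun Y => forall Z, S Z -> Ext_zero 1 Y Z.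

Definition right_perp (S : A -> Prop) : A -> Prop :=
  fun Y => forall Z, S Z -> Ext_zero 1 Z Y.

Definition cotorsion_pair (L R : A -> Prop) : Prop :=
  (forall X, L X <-> left_perp R X) /\ (forall X, R X <-> right_perp L X).

Definition complete_pair (L R : A -> Prop) : Prop :=
  forall X : A,
    (exists (R0 L0 : A) (f : hom R0 L0) (g : hom L0 X),
       [/\ L L0, R R0 & short_exact f g]) /\
    (exists (R1 L1 : A) (f : hom X R1) (g : hom R1 L1),
       [/\ L L1, R R1 & short_exact f g]).

Definition hereditary_pair (L R : A -> Prop) : Prop :=
  forall (n : nat) (X Y : A), (0 < n)%N -> L X -> R Y -> Ext_zero n X Y.

Definition hereditary_complete_cotorsion_pair (L R : A -> Prop) : Prop :=
  [/\ cotorsion_pair L R, complete_pair L R & hereditary_pair L R].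

Definition inter_class (L R : A -> Prop) : A -> Prop := fun X => L X /\ R X.

Definition contravariantly_finite (w : A -> Prop) : Prop :=
  forall X : A, exists (W : A) (f : hom W X), w W /\
    forall (W' : A) (g : hom W' X), w W' -> exists h : hom W' W, f ∘ h = g.

Record model_classes := ModelClasses {
  CoFib : forall X Y : A, hom X Y -> Prop;
  Fib : forall X Y : A, hom X Y -> Prop;
  Weq : forall X Y : A, hom X Y -> Prop }.

Definition model_of_pair (L R : A -> Prop) : model_classes := {|
  CoFib := fun X Y f =>
    mono f /\ exists (Q : A) (c : hom Y Q), is_cokernel f c /\ L Q;
  Fib := fun X Y f =>
    forall W : A, inter_class L R W ->
      forall g : hom W Y, exists h : hom W X, f ∘ h = g;
  Weq := fun X Y f =>
    exists (Z : A) (i : hom X Z) (p : hom Z Y),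
      [/\ f = p ∘ i,
          split_mono i,
          exists (Q : A) (c : hom Z Q), is_cokernel i c /\ inter_class L R Q,
          epi p
        & exists (K : A) (k : hom K Z), is_kernel p k /\ R K] |}.

Definition Ho (M : model_classes) : category :=
  @localization (cat_of A) (@Weq M).

End PreadditiveTheory.

Record additive_functor (C D : preadditive) := AdditiveFunctor {
  aob :> C -> D;
  amap : forall X Y : C, hom X Y -> hom (aob X) (aob Y);
  amap1 : forall X : C, amap (idm X) = idm (aob X);
  amapM : forall (X Y Z : C) (g : hom Y Z) (f : hom X Y),
    amap (g ∘ f) = amap g ∘ amap f;
  amapD : forall (X Y : C) (f g : hom X Y), amap (f + g) = amap f + amap g }.

Section AdditiveFunctor.
Variables (C D : preadditive) (G : additive_functor C D).

Lemma amap0 (X Y : C) : amap G (0 : hom X Y) = 0.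
Proof. by apply: (addrI (amap G 0)); rewrite -amapD !addr0. Qed.

Lemma amapN (X Y : C) (f : hom X Y) : amap G (- f) = - amap G f.
Proof. by apply: (addrI (amap G f)); rewrite -amapD !subrr amap0. Qed.

Definition right_exact : Prop :=
  forall (X Y Z : C) (f : hom X Y) (g : hom Y Z), short_exact f g ->
    exact (amap G f) (amap G g) /\ epi (amap G g).

(* [H] is the value at [X] of the first left derived functor of [G] (defined up
   to isomorphism). *)
Definition is_L1 (X : C) (H : D) : Prop :=
  exists P : proj_resolution X,
    is_homology (amap G (res_d P 1)) (amap G (res_d P 0)) H.

Record comma_ob := CommaOb {
  comma_src : C;
  comma_tgt : D;
  comma_map : hom (G comma_src) comma_tgt }.

Section CommaHom.
Variables Z Z' : comma_ob.

Definition comma_pred :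
    pred (hom (comma_src Z) (comma_src Z') * hom (comma_tgt Z) (comma_tgt Z')) :=
  fun ab => comma_map Z' ∘ amap G ab.1 == ab.2 ∘ comma_map Z.

Lemma comma_zmod_closed : zmod_closed comma_pred.
Proof.
split=> [|[a b] [a' b']]; rewrite !unfold_in /comma_pred /=.
  by rewrite amap0 comp0l comp0r.
move=> /eqP h /eqP h'.
by rewrite amapD amapN compDr compNr compDl compNl h h'.
Qed.

HB.instance Definition _ :=
  GRing.isZmodClosed.Build _ comma_pred comma_zmod_closed.

Record comma_hom := CommaHom {
  comma_val :> hom (comma_src Z) (comma_src Z') *
               hom (comma_tgt Z) (comma_tgt Z');
  comma_valP : comma_val \in comma_pred }.

HB.instance Definition _ := [isSub for comma_val].
HB.instance Definition _ := [Choice of comma_hom by <:].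
HB.instance Definition _ := [SubChoice_isSubZmodule of comma_hom by <:].

Lemma comma_valD (f g : comma_hom) :
  comma_val (f + g) = comma_val f + comma_val g.
Proof. exact: (raddfD (val : comma_hom -> _)). Qed.

Lemma comma_hom_eq (f g : comma_hom) : f.1 = g.1 -> f.2 = g.2 -> f = g.
Proof.
case: f g => [[a b] h] [[a' b'] h'] /= ea eb; apply: val_inj => /=.
by rewrite ea eb.
Qed.

End CommaHom.

Lemma comma_id_subproof (Z : comma_ob) :
  (idm (comma_src Z), idm (comma_tgt Z)) \in @comma_pred Z Z.
Proof. by rewrite unfold_in /comma_pred /= amap1 comp1l comp1r. Qed.

Definition comma_id (Z : comma_ob) : comma_hom Z Z :=
  CommaHom (comma_id_subproof Z).

Lemma comma_comp_subproof (Z1 Z2 Z3 : comma_ob)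
    (g : comma_hom Z2 Z3) (f : comma_hom Z1 Z2) :
  (g.1 ∘ f.1, g.2 ∘ f.2) \in @comma_pred Z1 Z3.
Proof.
case: g f => [[a b] /= /eqP h] [[a' b'] /= /eqP h'].
rewrite unfold_in /comma_pred /=; apply/eqP.
by rewrite amapM compA h -compA h' compA.
Qed.

Definition comma_comp (Z1 Z2 Z3 : comma_ob)
    (g : comma_hom Z2 Z3) (f : comma_hom Z1 Z2) : comma_hom Z1 Z3 :=
  CommaHom (comma_comp_subproof g f).

Program Definition comma : preadditive :=
  @Preadditive comma_ob (fun Z Z' => comma_hom Z Z') comma_id comma_comp
    _ _ _ _ _.
Next Obligation. by move=> *; apply: comma_hom_eq; rewrite /= compA. Qed.
Next Obligation. by move=> *; apply: comma_hom_eq; rewrite /= comp1l. Qed.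
Next Obligation. by move=> *; apply: comma_hom_eq; rewrite /= comp1r. Qed.
Next Obligation.
by move=> *; apply: comma_hom_eq; rewrite !comma_valD /= ?comma_valD /= compDl.
Qed.
Next Obligation.
by move=> *; apply: comma_hom_eq; rewrite !comma_valD /= ?comma_valD /= compDr.
Qed.

Definition comma_class (S : C -> Prop) (T : D -> Prop) : comma -> Prop :=
  fun Z => S (comma_src Z) /\ T (comma_tgt Z).

Definition comma_diag (U : C) : comma := CommaOb (idm (G U)).

Definition comma_zero (O : C) (V : D) : comma := CommaOb (0 : hom (G O) V).

(* The objects isomorphic to (U, G U)_1 ⊕ (0, V)_0 with [U] in [S] and [V] in
   [T]. *)
Definition comma_sum_class (S : C -> Prop) (T : D -> Prop) : comma -> Prop :=
  fun Z => exists (U : C) (O : C) (V : D),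
    [/\ S U, T V, is_zero O
      & is_direct_sum (comma_diag U) (comma_zero O V) Z].

End AdditiveFunctor.

(* Main.v *)
From mathcomp Require Import all_boot ssralg generic_quotient ring_quotient boolp.
Require Import Defs.
Set Implicit Arguments.
Unset Strict Implicit.
Unset Printing Implicit Defensive.
Import GRing.Theory.
Local Open Scope ring_scope.
Local Open Scope cat_scope.

(* Since G(U) lies in Y, an object (A, B)_f is in the left orthogonal class iff
   A is in U and f is a split monomorphism with cokernel in V: extending the
   identity of G(A) along f gives the splitting.  The vanishing of L_1 G on U
   says that G preserves short exact sequences ending in U; this gives the right
   orthogonal, the second approximation sequence (through a pushout of
   G(A) -> G(X_1) along f) and, with a snake argument, closure under syzygies.
   For any complete cotorsion pair (L, R) with core w, left approximations
   identify A[Weq_w^-1] with the additive quotient L/w.  In the comma category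
   every morphism V -> G(U') factors through V ∩ Y, so modulo the core only the
   diagonal entries of a morphism (U, G U) + (0, V) -> (U', G U') + (0, V')
   survive, and L/w is the product of the two quotients of C and D. *)

(** * Kernels and cokernels in abelian categories *)

(** [Ext_zero] quantifies over all projective resolutions, and resolutions in the comma category are
    awkward to describe. The working notion is therefore [ext1]: every map out of the kernel of an
    epimorphism onto the object extends. It is compared with [Ext_zero] in [Ext1P], and higher
    degrees reduce to degree one by dimension shift along syzygies. Each orthogonality in the comma
    category is then tested on a short exact sequence built by hand. Diagram chases use generalized
    elements: a map lifts along an epimorphism after composition with an epimorphism onto its source
    ([epi_lift]). The two hypotheses on G act in different places. The inclusion of G(U) in Y makes
    (0, G A)_0 a legitimate test object for A in U, puts the kernel of the first approximation in
    the right class, and lets every V -> G(U') factor through the core. The vanishing of L_1 G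
    enters through [amap_ses]. *)

Section Preadditive.
Variable A : preadditive.
Implicit Types X Y Z T : A.

Lemma compBl X Y Z (g g' : hom Y Z) (f : hom X Y) :
  (g - g') ∘ f = g ∘ f - g' ∘ f.
Proof. by rewrite compDl compNl. Qed.

Lemma compBr X Y Z (g : hom Y Z) (f f' : hom X Y) :
  g ∘ (f - f') = g ∘ f - g ∘ f'.
Proof. by rewrite compDr compNr. Qed.

Lemma compE X Y Z T (g : hom Y Z) (f : hom X Y) (u : hom X Z) (h : hom Z T) :
  g ∘ f = u -> h ∘ g ∘ f = h ∘ u.
Proof. by move=> <-; rewrite compA. Qed.

Lemma mono0P X Y (f : hom X Y) :
  mono f <-> forall T (t : hom T X), f ∘ t = 0 -> t = 0.
Proof.
split=> [mf T t ft0|h T s t /eqP].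
  by apply: mf; rewrite ft0 comp0r.
by rewrite -subr_eq0 -compBr => /eqP/h/eqP; rewrite subr_eq0 => /eqP.
Qed.

Lemma epi0P X Y (f : hom X Y) :
  epi f <-> forall T (t : hom Y T), t ∘ f = 0 -> t = 0.
Proof.
split=> [mf T t ft0|h T s t /eqP].
  by apply: mf; rewrite ft0 comp0l.
by rewrite -subr_eq0 -compBl => /eqP/h/eqP; rewrite subr_eq0 => /eqP.
Qed.

Lemma mono_idm X : mono (idm X).
Proof. by move=> T g h; rewrite !comp1l. Qed.

Lemma epi_idm X : epi (idm X).
Proof. by move=> T g h; rewrite !comp1r. Qed.

Lemma mono_comp X Y Z (g : hom Y Z) (f : hom X Y) :
  mono g -> mono f -> mono (g ∘ f).
Proof. by move=> mg mf T s t; rewrite -!compA => /mg/mf. Qed.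

Lemma epi_comp X Y Z (g : hom Y Z) (f : hom X Y) :
  epi g -> epi f -> epi (g ∘ f).
Proof. by move=> eg ef T s t; rewrite !compA => /ef/eg. Qed.

Lemma mono_comp_r X Y Z (g : hom Y Z) (f : hom X Y) : mono (g ∘ f) -> mono f.
Proof. by move=> mgf T s t e; apply: mgf; rewrite -!compA e. Qed.

Lemma epi_comp_l X Y Z (g : hom Y Z) (f : hom X Y) : epi (g ∘ f) -> epi g.
Proof. by move=> egf T s t e; apply: egf; rewrite !compA e. Qed.

Lemma section_mono X Y (f : hom X Y) (r : hom Y X) : r ∘ f = idm X -> mono f.
Proof. by move=> rf; apply: (@mono_comp_r _ _ _ r); rewrite rf; exact: mono_idm. Qed.

Lemma retraction_epi X Y (f : hom X Y) (s : hom Y X) : f ∘ s = idm Y -> epi f.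
Proof. by move=> fs; apply: (@epi_comp_l _ _ _ f s); rewrite fs; exact: epi_idm. Qed.

Lemma kerP X Y K (f : hom X Y) (k : hom K X) :
  is_kernel f k <->
  [/\ f ∘ k = 0, mono k
    & forall T (t : hom T X), f ∘ t = 0 -> exists s : hom T K, k ∘ s = t].
Proof.
split=> [[fk0 uk]|[fk0 mk lk]].
  split=> // [|T t /uk[s [ks _]]]; last by exists s.
  apply/mono0P => T t kt; have [s [_ us]] := uk T 0 (comp0r _ _).
  by rewrite -(us t kt) (us 0 (comp0r _ _)).
split=> // T t /lk[s ks]; exists s; split=> // s' ks'.
by apply: mk; rewrite ks ks'.
Qed.

Lemma cokerP X Y Q (f : hom X Y) (c : hom Y Q) :
  is_cokernel f c <->
  [/\ c ∘ f = 0, epi c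
    & forall T (t : hom Y T), t ∘ f = 0 -> exists s : hom Q T, s ∘ c = t].
Proof.
split=> [[fk0 uk]|[fk0 mk lk]].
  split=> // [|T t /uk[s [ks _]]]; last by exists s.
  apply/epi0P => T t kt; have [s [_ us]] := uk T 0 (comp0l _ _).
  by rewrite -(us t kt) (us 0 (comp0l _ _)).
split=> // T t /lk[s ks]; exists s; split=> // s' ks'.
by apply: mk; rewrite ks ks'.
Qed.

Lemma ker_comp0 X Y K (f : hom X Y) (k : hom K X) : is_kernel f k -> f ∘ k = 0.
Proof. by case. Qed.

Lemma ker_mono X Y K (f : hom X Y) (k : hom K X) : is_kernel f k -> mono k.
Proof. by case/kerP. Qed.

Lemma ker_lift X Y K (f : hom X Y) (k : hom K X) : is_kernel f k ->
  forall T (t : hom T X), f ∘ t = 0 -> exists s : hom T K, k ∘ s = t.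
Proof. by case/kerP. Qed.

Lemma coker_epi X Y Q (f : hom X Y) (c : hom Y Q) : is_cokernel f c -> epi c.
Proof. by case/cokerP. Qed.

Lemma coker_desc X Y Q (f : hom X Y) (c : hom Y Q) : is_cokernel f c ->
  forall T (t : hom Y T), t ∘ f = 0 -> exists s : hom Q T, s ∘ c = t.
Proof. by case/cokerP. Qed.

Lemma ker_monol X Y Z K (m : hom Y Z) (f : hom X Y) (k : hom K X) :
  mono m -> is_kernel f k -> is_kernel (m ∘ f) k.
Proof.
move=> mm /kerP[fk mk lk]; apply/kerP; split=> //; first by rewrite -compA fk comp0r.
by move=> T t; rewrite -compA => /(proj1 (mono0P m) mm); exact: lk.
Qed.

Lemma ker_monol_inv X Y Z K (m : hom Y Z) (f : hom X Y) (k : hom K X) :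
  mono m -> is_kernel (m ∘ f) k -> is_kernel f k.
Proof.
move=> mm /kerP[fk mk lk]; apply/kerP; split=> //.
  by apply: (proj1 (mono0P m) mm); rewrite compA.
by move=> T t ft; apply: lk; rewrite -compA ft comp0r.
Qed.

Lemma coker_epir X Y Z Q (f : hom Y Z) (e : hom X Y) (c : hom Z Q) :
  epi e -> is_cokernel f c -> is_cokernel (f ∘ e) c.
Proof.
move=> ee /cokerP[fk mk lk]; apply/cokerP; split=> //; first by rewrite compA fk comp0l.
by move=> T t; rewrite compA => /(proj1 (epi0P e) ee); exact: lk.
Qed.

Lemma zero_hom_l X Y : is_zero X -> forall f : hom X Y, f = 0.
Proof. by move=> /(_ Y)[]. Qed.

Lemma zero_hom_r X Y : is_zero Y -> forall f : hom X Y, f = 0.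
Proof. by move=> /(_ X)[]. Qed.

(** Short exactness without the image factorization hidden in [short_exact]; the two agree in an
    abelian category by [short_exactP]. *)
Definition ses X Y Z (f : hom X Y) (g : hom Y Z) := is_kernel g f /\ epi g.

End Preadditive.

(** * Image factorization, pullbacks and chases with generalized elements *)

Section Abelian.
Variables (A : preadditive) (abA : abelian A).
Implicit Types X Y Z T : A.

Lemma zero_ob : exists O : A, is_zero O.
Proof. by case: abA. Qed.

Lemma sum_ob X Y : exists B : A, is_direct_sum X Y B.
Proof. by case: abA. Qed.

Lemma ker_ex X Y (f : hom X Y) : exists (K : A) (k : hom K X), is_kernel f k.
Proof. by case: abA => _ _ /(_ X Y f)[]. Qed.

Lemma coker_ex X Y (f : hom X Y) : exists (Q : A) (c : hom Y Q), is_cokernel f c.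
Proof. by case: abA => _ _ /(_ X Y f)[]. Qed.

(** The axiom presents [f] as the kernel of some [g], which factors through the cokernel [c]; so
    whatever [c] kills, [g] kills. *)
Lemma mono_ker X Y Q (f : hom X Y) (c : hom Y Q) :
  mono f -> is_cokernel f c -> is_kernel c f.
Proof.
move=> mf cf; case: abA => _ _ _ /(_ X Y f mf)[Z [g gf]] _.
apply/kerP; split=> //; first by case: cf.
move=> T t ct; have [u ug] := coker_desc cf (ker_comp0 gf).
by apply: (ker_lift gf); rewrite -ug -compA ct comp0r.
Qed.

Lemma epi_coker X Y K (f : hom X Y) (k : hom K X) :
  epi f -> is_kernel f k -> is_cokernel k f.
Proof.
move=> ef kf; case: abA => _ _ _ _ /(_ X Y f ef)[Z [g gf]].
apply/cokerP; split=> //; first by case: kf.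
have [u ug] := ker_lift kf (proj1 gf).
by move=> T t ct; apply: (coker_desc gf); rewrite -ug compA ct comp0l.
Qed.

Lemma ses_coker X Y Z (f : hom X Y) (g : hom Y Z) : ses f g -> is_cokernel f g.
Proof. by case=> kf eg; exact: epi_coker. Qed.

Lemma mono_ses X Y (f : hom X Y) : mono f -> exists (Z : A) (g : hom Y Z), ses f g.
Proof.
move=> mf; have [Z [g gf]] := coker_ex f; exists Z, g.
by split; [exact: mono_ker|exact: coker_epi gf].
Qed.

Lemma epi_ses Y Z (g : hom Y Z) : epi g -> exists (X : A) (f : hom X Y), ses f g.
Proof. by move=> eg; have [X [f fg]] := ker_ex g; exists X, f. Qed.

Lemma mono_epi_iso X Y (f : hom X Y) :
  mono f -> epi f -> exists g : hom Y X, g ∘ f = idm X /\ f ∘ g = idm Y.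
Proof.
move=> mf ef; have [K [k kf]] := ker_ex f.
have k0 : k = 0 by apply: (proj1 (mono0P f) mf); case: kf.
have [g gf] : exists g, g ∘ f = idm X.
  by apply: (coker_desc (epi_coker ef kf)); rewrite k0 comp0r.
by exists g; split=> //; apply: ef; rewrite -compA gf comp1l comp1r.
Qed.

(** The image is the kernel [m] of the cokernel. If [t] kills [e], then [f] factors through [m ∘ n]
    with [n] the kernel of [t]; this mono is the kernel of its own cokernel, so [m] factors through
    it too. Hence [n] has a right inverse and [t = 0]. *)
Lemma epi_mono_factor X Y (f : hom X Y) :
  exists (I : A) (e : hom X I) (m : hom I Y), [/\ epi e, mono m & m ∘ e = f].
Proof.
have [Q [c cf]] := coker_ex f; have [I [m mc]] := ker_ex c.
have [e me] := ker_lift mc (proj1 cf); exists I, e, m.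
split=> //; last exact: ker_mono mc.
apply/epi0P => T t te; have [J [n nt]] := ker_ex t.
have [e' ne'] := ker_lift nt te.
have mmn : mono (m ∘ n) by apply: mono_comp; [exact: ker_mono mc|exact: ker_mono nt].
have [Q' [c' c'mn]] := coker_ex (m ∘ n); have kmn := mono_ker mmn c'mn.
have [u uc] : exists u, u ∘ c = c'.
  apply: (coker_desc cf); rewrite -me -ne' (compA m) compA (proj1 c'mn).
  by rewrite comp0l.
have [v mnv] : exists v, (m ∘ n) ∘ v = m.
  by apply: (ker_lift kmn); rewrite -uc -compA (proj1 mc) comp0r.
have nv : n ∘ v = idm I by apply: (ker_mono mc); rewrite compA mnv comp1r.
by rewrite -(comp1r t) -nv compA (proj1 nt) comp0l.
Qed.

Lemma short_exactP X Y Z (f : hom X Y) (g : hom Y Z) :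
  short_exact f g <-> ses f g.
Proof.
split=> [[mf [K [k [e [kg ee ke]]]] eg]|[kf eg]]; last first.
  split=> //; first exact: ker_mono kf.
  by exists X, f, (idm X); split; [|exact: epi_idm|rewrite comp1r].
split=> //; have me : mono e by apply: (@mono_comp_r _ _ _ _ k); rewrite ke.
have [h [he eh]] := mono_epi_iso me ee; apply/kerP; split=> //.
  by rewrite -ke compA (proj1 kg) comp0l.
move=> T t gt; have [s ks] := ker_lift kg gt.
by exists (h ∘ s); rewrite -ke compA -(compA _ e) eh comp1r.
Qed.

(** The pullback is the kernel of [d = q ∘ p1 - f ∘ p2]. For stability of epis: if [t] kills [h2],
    then [t ∘ p2] descends along [d] to some [u]; restriction to [X] gives [u ∘ q = 0], so [u = 0],
    and restriction to [Y] gives [t = 0]. *)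
Lemma pullback_ex X Y Z (q : hom X Z) (f : hom Y Z) :
  exists (H : A) (h1 : hom H X) (h2 : hom H Y),
  [/\ q ∘ h1 = f ∘ h2,
      forall T (s t : hom T H), h1 ∘ s = h1 ∘ t -> h2 ∘ s = h2 ∘ t -> s = t,
      forall T (t1 : hom T X) (t2 : hom T Y), q ∘ t1 = f ∘ t2 ->
        exists t : hom T H, h1 ∘ t = t1 /\ h2 ∘ t = t2
    & epi q -> epi h2].
Proof.
have [B [i1 [i2 [p1 [p2 [pi11 pi22 pi12 pi21 ip]]]]]] := sum_ob X Y.
set d := q ∘ p1 - f ∘ p2; have [H [h hd]] := ker_ex d.
have [dh mh lh] := (proj1 (kerP _ _)) hd.
exists H, (p1 ∘ h), (p2 ∘ h); split.
- by apply/eqP; rewrite -subr_eq0 !compA -compBl -/d dh.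
- move=> T s t e1 e2; apply: mh; rewrite -[h]comp1l -ip !compDl.
  by rewrite -!compA (compA p1) (compA p2) e1 e2 -!compA.
- move=> T t1 t2 e; have [|t ht] := lh T (i1 ∘ t1 + i2 ∘ t2).
    rewrite /d compBl !compDr !compA !(compE _ pi11) !(compE _ pi22).
    by rewrite !(compE _ pi12) !(compE _ pi21) !comp0r !comp0l !comp1r addr0 add0r e subrr.
  exists t; rewrite -!compA ht !compDr !compA pi11 pi12 pi21 pi22.
  by rewrite !comp0l !comp1l addr0 add0r.
- move=> eq; apply/epi0P => T t th.
  have ed : epi d.
    apply: (@epi_comp_l _ _ _ _ _ i1).
    by rewrite /d compBl (compE _ pi11) (compE _ pi21) comp1r comp0r subr0.
  have [u ud] : exists u, u ∘ d = t ∘ p2.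
    by apply: (coker_desc (epi_coker ed hd)); rewrite -compA.
  have u0 : u = 0.
    apply: (proj1 (epi0P q) eq); move: (congr1 (fun x => x ∘ i1) ud).
    by rewrite /d -!compA pi21 compBl (compE _ pi11) (compE _ pi21) !comp0r comp1r subr0.
  by rewrite -(comp1r t) -pi22 compA -ud u0 !comp0l.
Qed.

(** Substitute for choosing a preimage of an element: the lift exists on an epimorphic cover of the
    source. *)
Lemma epi_lift X Y T (e : hom X Y) (t : hom T Y) : epi e ->
  exists (T' : A) (e' : hom T' T) (t' : hom T' X), epi e' /\ e ∘ t' = t ∘ e'.
Proof.
move=> ee; have [H [h1 [h2 [c _ _ eh]]]] := pullback_ex e t.
by exists H, h2, h1; split=> //; exact: eh.
Qed.

(** The lifting property of a kernel may be checked on epimorphic covers: [k] is the kernel of its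
    cokernel [c], and [c] kills [t] as soon as it kills [t ∘ e]. *)
Lemma kernel_of_local X Y K (f : hom X Y) (k : hom K X) :
  mono k -> f ∘ k = 0 ->
  (forall T (t : hom T X), f ∘ t = 0 ->
    exists (T' : A) (e : hom T' T) (s : hom T' K), epi e /\ k ∘ s = t ∘ e) ->
  is_kernel f k.
Proof.
move=> mk fk h; apply/kerP; split=> // T t /h[T' [e [s [ee es]]]].
have [Q [c ck]] := coker_ex k; apply: (ker_lift (mono_ker mk ck)).
by apply: (proj1 (epi0P e) ee); rewrite -compA -es compA (proj1 ck) comp0l.
Qed.

Lemma exactP X Y Z (f : hom X Y) (g : hom Y Z) :
  exact f g <-> g ∘ f = 0 /\ forall T (t : hom T Y), g ∘ t = 0 ->
    exists (T' : A) (e : hom T' T) (s : hom T' X), epi e /\ f ∘ s = t ∘ e.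
Proof.
split=> [[K [k [e [kg ee ke]]]]|[gf h]].
  split=> [|T t /(ker_lift kg)[s ks]]; first by rewrite -ke compA (proj1 kg) comp0l.
  have [T' [e' [t' [ee' et']]]] := epi_lift s ee.
  by exists T', e', t'; rewrite -ke -compA et' compA ks.
have [K [k kg]] := ker_ex g; have [e ke] := ker_lift kg gf.
exists K, k, e; split=> //; have [T [t [s [et ks]]]] := h K k (proj1 kg).
apply: (@epi_comp_l _ _ _ _ _ s); suff -> : e ∘ s = t by [].
by apply: (ker_mono kg); rewrite compA ke ks.
Qed.

Lemma pullback_ses R X Y Z (r : hom R X) (q : hom X Z) (f : hom Y Z) :
  ses r q ->
  exists (H : A) (h1 : hom H X) (h2 : hom H Y) (r' : hom R H),
  [/\ q ∘ h1 = f ∘ h2, h1 ∘ r' = r, ses r' h2,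
      forall T (s t : hom T H), h1 ∘ s = h1 ∘ t -> h2 ∘ s = h2 ∘ t -> s = t
    & forall T (t1 : hom T X) (t2 : hom T Y), q ∘ t1 = f ∘ t2 ->
        exists t : hom T H, h1 ∘ t = t1 /\ h2 ∘ t = t2].
Proof.
move=> [kr eq]; have [H [h1 [h2 [c uh lh eh]]]] := pullback_ex q f.
have [|r' [r1 r2]] := lh R r 0; first by rewrite comp0r; case: kr.
exists H, h1, h2, r'; do 2?[split=> //]; last exact: eh.
apply/kerP; split=> //.
  by apply: (@mono_comp_r _ _ _ _ h1); rewrite r1; exact: ker_mono kr.
move=> T t ht; have [|s rs] := ker_lift kr (t := h1 ∘ t).
  by rewrite compA c -compA ht comp0r.
by exists s; apply: uh; rewrite compA ?r1 // r2 comp0l ht.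
Qed.

Lemma ses_id0 X O : is_zero O -> ses (idm X) (0 : hom X O).
Proof.
move=> zO; split; last by apply/epi0P => T t _; exact: zero_hom_l.
apply/kerP; split; [by rewrite comp0l|exact: mono_idm|].
by move=> T t _; exists t; rewrite comp1l.
Qed.

Lemma ses_0id X O : is_zero O -> ses (0 : hom O X) (idm X).
Proof.
move=> zO; split; last exact: epi_idm.
apply/kerP; split.
- by rewrite comp0r.
- by apply/mono0P => T t _; exact: zero_hom_r.
by move=> T t; rewrite comp1l => ->; exists 0; rewrite comp0l.
Qed.

Lemma split_mono_sum X B (i : hom X B) (r : hom B X) : r ∘ i = idm X ->
  exists (Q : A) (j : hom Q B) (s : hom B Q),
  [/\ r ∘ i = idm X, s ∘ j = idm Q, r ∘ j = 0, s ∘ i = 0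
    & i ∘ r + j ∘ s = idm B].
Proof.
move=> ri; have [Q [j kj]] := ker_ex r.
have [|s js] := ker_lift kj (t := idm B - i ∘ r).
  by rewrite compBr compA ri comp1l comp1r subrr.
have mj := ker_mono kj; exists Q, j, s; split=> //.
- by apply: mj; rewrite compA js compBl -compA (proj1 kj) comp0r subr0 comp1l comp1r.
- by case: kj.
- by apply: mj; rewrite compA js compBl -compA ri comp1l comp1r subrr comp0r.
by rewrite js addrC subrK.
Qed.

(** Every extension of [X] is a pushout of a projective presentation of [X]: [E] is the pushout of
    [k] along [m], written as the exact sequence 0 -> K -> K' ⊕ P -> E -> 0. *)
Lemma ses_cover X E K K' P (k' : hom K' E) (p' : hom E X) (k : hom K P) (p : hom P X)
    (l : hom P E) B (i1 : hom K' B) (i2 : hom P B) (p1 : hom B K') (p2 : hom B P) :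
  ses k' p' -> ses k p -> p' ∘ l = p ->
  [/\ p1 ∘ i1 = idm K', p2 ∘ i2 = idm P, p1 ∘ i2 = 0, p2 ∘ i1 = 0
      & i1 ∘ p1 + i2 ∘ p2 = idm B] ->
  exists m : hom K K',
    k' ∘ m = l ∘ k /\ ses (i1 ∘ m - i2 ∘ k) (k' ∘ p1 + l ∘ p2).
Proof.
move=> [kk' ep'] [kk ep] p'l [p11 p22 p12 p21 ip].
have [|m k'm] := ker_lift kk' (t := l ∘ k).
  by rewrite compA p'l; case: kk.
exists m; split=> //; set d := k' ∘ p1 + l ∘ p2; set phi := _ - _.
have di1 : d ∘ i1 = k' by rewrite compDl -!compA p11 p21 comp0r comp1r addr0.
have di2 : d ∘ i2 = l by rewrite compDl -!compA p12 p22 comp0r comp1r add0r.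
have p2phi : p2 ∘ phi = - k by rewrite compBr !compA p21 p22 comp0l comp1l sub0r.
split.
  apply/kerP; split.
  - by rewrite compBr !compA di1 di2 k'm subrr.
  - apply/mono0P => T t ht; apply: (proj1 (mono0P k) (ker_mono kk)).
    by apply: oppr_inj; rewrite -compNl -p2phi -compA ht comp0r oppr0.
  move=> T t; rewrite compDl -!compA => dt.
  have p2t : p ∘ (p2 ∘ t) = 0.
    rewrite -p'l -compA -[l ∘ _](addKr (k' ∘ (p1 ∘ t))) dt addr0 compNr compA.
    by rewrite (proj1 kk') comp0l oppr0.
  have [y ky] := ker_lift kk p2t.
  have p1t : p1 ∘ t = - (m ∘ y).
    apply: (ker_mono kk'); rewrite compNr (compA k' m) k'm -(compA l) ky.
    by apply/eqP; rewrite -addr_eq0 dt.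
  exists (- y); rewrite compNr compBl -!compA ky -[m ∘ y]opprK -p1t compNr.
  by rewrite -opprD opprK !compA -compDl ip comp1l.
apply/epi0P => T s sd.
have [|u up'] := coker_desc (epi_coker ep' kk') (t := s).
  by rewrite -di1 compA sd comp0l.
suff u0 : u = 0 by rewrite -up' u0 comp0l.
by apply: (proj1 (epi0P p) ep); rewrite -p'l compA up' -di2 compA sd comp0l.
Qed.

Lemma ses_split_sum X Y B (i1 : hom X B) (i2 : hom Y B) (p1 : hom B X) (p2 : hom B Y) :
  p2 ∘ i1 = 0 -> p2 ∘ i2 = idm Y -> i1 ∘ p1 + i2 ∘ p2 = idm B -> p1 ∘ i1 = idm X ->
  ses i1 p2.
Proof.
move=> p21 p22 ip p11; split; last exact: retraction_epi p22.
apply/kerP; split=> //; first exact: section_mono p11.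
move=> T t pt; exists (p1 ∘ t).
by rewrite -[RHS]comp1l -ip compDl -!compA pt comp0r addr0.
Qed.

End Abelian.

(** * The first Ext group and cotorsion pairs *)

Lemma quot_eq0P (R : zmodType) (I : zmodClosed R) :
  (forall e : Quotient.quot I, e = 0) <-> (forall x : R, x \in I).
Proof.
have pi0 : (\pi_(Quotient.quot I)%qT 0 = 0) by exact: pi_zeror.
split=> h x.
  have := h (\pi_(Quotient.quot I)%qT x); rewrite -pi0.
  by move/eqP; rewrite -Quotient.idealrBE subr0.
by rewrite -[x]reprK -pi0; apply/eqP; rewrite -Quotient.idealrBE subr0.
Qed.

Section ExtZero.
Variable A : preadditive.
Implicit Types X Y Z T : A.

Lemma Ext_zeroP n X Y : Ext_zero n.+1 X Y <->
  forall (P : proj_resolution X) (f : hom (res_ob P n.+1) Y),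
    f ∘ res_d P n.+1 = 0 -> exists g : hom (res_ob P n) Y, f = g ∘ res_d P n.
Proof.
split=> [h P f f0|h P].
  have fP : f \in @cocycle_pred A X P Y n.+1 by rewrite unfold_in; apply/eqP.
  have := (proj1 (quot_eq0P _) (h P)) (Cocycle fP).
  by rewrite unfold_in => /asboolP.
apply: (proj2 (quot_eq0P _)) => -[f fP]; rewrite unfold_in; apply/asboolP.
by apply: h; have := fP; rewrite unfold_in => /eqP.
Qed.

(** Vanishing of Ext^1 in Yoneda form. Allowing an arbitrary [f] in place of the identity of [Y]
    builds the pushout of the extension along [f] into the definition. *)
Definition ext1 X Y := forall (K E : A) (k : hom K E) (p : hom E X),
  ses k p -> forall f : hom K Y, exists g : hom E Y, g ∘ k = f.

(** * Dimension shift for projective resolutions *)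

Section Splice.
Variables (X K P0 : A) (k : hom K P0) (p : hom P0 X).
Hypotheses (kp : ses k p) (projP : projective P0).
Variable Q : proj_resolution K.

(** A resolution of the syzygy [K] prolonged by [P0]: degree n+1 of the new resolution is degree n
    of [Q]. *)
Definition splice_ob n : A := if n is m.+1 then res_ob Q m else P0.

Definition splice_d n : hom (splice_ob n.+1) (splice_ob n) :=
  match n return hom (splice_ob n.+1) (splice_ob n) with
  | 0 => k ∘ res_aug Q
  | m.+1 => res_d Q m
  end.

Lemma splice_proj n : projective (splice_ob n).
Proof. by case: n => [|n] //=; exact: res_projective. Qed.

Lemma splice_exact0 : exact (splice_d 0) p.
Proof. by exists K, k, (res_aug Q); split=> //; [case: kp|exact: res_aug_epi]. Qed.

Lemma splice_exact n : exact (splice_d n.+1) (splice_d n).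
Proof.
case: n => [|n] /=; last exact: res_exact.
have [K' [k' [e [kk ee ke]]]] := res_exact0 Q.
exists K', k', e; split=> //; apply: ker_monol => //; exact: (ker_mono (proj1 kp)).
Qed.

Definition splice : proj_resolution X :=
  ProjResolution splice_proj (proj2 kp) splice_exact0 splice_exact.

End Splice.

Section Tail.
Variables (X K : A) (P : proj_resolution X) (k : hom K (res_ob P 0)).
Variable e : hom (res_ob P 1) K.
Hypotheses (kP : is_kernel (res_aug P) k) (ee : epi e) (ke : k ∘ e = res_d P 0).

Lemma tail_exact0 : exact (res_d P 1) e.
Proof.
have [K' [k' [e' [kk e'e ke']]]] := res_exact P 0.
exists K', k', e'; split=> //; apply: (@ker_monol_inv _ _ _ _ _ k); first exact: ker_mono kP.
by rewrite ke.
Qed.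

(** Converse of [splice]: without its degree 0, a resolution of [X] resolves the first syzygy. *)
Definition tail : proj_resolution K :=
  @ProjResolution A K (fun n => res_ob P n.+1) (fun n => res_d P n.+1) e
    (fun n => @res_projective A X P n.+1) ee tail_exact0
    (fun n => @res_exact A X P n.+1).

End Tail.

Hypothesis abA : abelian A.

(** One projective presentation suffices, because any other extension is a pushout of it: [f] on
    [K'] and the extension [g] of [f ∘ m] agree on [K], so together they descend to [E]. *)
Lemma ext1_of_proj X Y K P (k : hom K P) (p : hom P X) :
  projective P -> ses k p ->
  (forall f : hom K Y, exists g : hom P Y, g ∘ k = f) -> ext1 X Y.
Proof.
move=> prP kp h K' E k' p' kp' f.
have [l p'l] := prP _ _ _ p (proj2 kp').
have [B [i1 [i2 [p1 [p2 e]]]]] := sum_ob abA K' P.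
have [m [k'm sB]] := ses_cover abA kp' kp p'l e; have [p11 p22 p12 p21 ip] := e.
have [g gk] := h (f ∘ m).
have [|h' h'd] := coker_desc (ses_coker abA sB) (t := f ∘ p1 + g ∘ p2).
  rewrite compBr !compDl !compA !(compE _ p11) !(compE _ p12) !(compE _ p21).
  by rewrite !(compE _ p22) !comp0r !comp0l !comp1r addr0 add0r gk subrr.
exists h'; move: (congr1 (fun x => x ∘ i1) h'd).
by rewrite compDr !compDl !compA !(compE _ p11) !(compE _ p21) !comp0r !comp1r !addr0.
Qed.

(** The pullback of the sequence along [f] splits; [h1], corrected by the splitting, kills [R] and
    descends to the lift. *)
Lemma ext1_lift M R E B (r : hom R E) (q : hom E B) :
  ext1 M R -> ses r q -> forall f : hom M B, exists g : hom M E, q ∘ g = f.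
Proof.
move=> xMR rq f.
have [H [h1 [h2 [r' [c h1r sr _ _]]]]] := pullback_ses abA f rq.
have [s sr'] := xMR _ _ _ _ sr (idm R).
have [|g gh] := coker_desc (ses_coker abA sr) (t := h1 - r ∘ s).
  by rewrite compBl h1r -compA sr' comp1r subrr.
exists g; apply: (proj2 sr); rewrite -compA gh compBr c compA.
by rewrite (ker_comp0 (proj1 rq)) comp0l subr0.
Qed.

Lemma ext1_proj P Y : projective P -> ext1 P Y.
Proof.
move=> prP; have [O zO] := zero_ob abA.
apply: (@ext1_of_proj _ _ O P 0 (idm P)) => //.
  exact: ses_0id.
by move=> f; exists 0; rewrite comp0l (zero_hom_l zO f).
Qed.

(** The preimage [F1] of [X1] in [F], taken as the kernel of [q ∘ p], is an extension of [X1] by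
    [K]. The map extends from [K] to [F1], and then to [F], whose quotient by [F1] is [X2]. *)
Lemma ext1_extl Y X1 X X2 (i : hom X1 X) (q : hom X X2) :
  ses i q -> ext1 X1 Y -> ext1 X2 Y -> ext1 X Y.
Proof.
move=> [ki eq] x1 x2 K F k p [kk ep] f.
have [F1 [j kj]] := ker_ex abA (q ∘ p).
have sj : ses j (q ∘ p) by split=> //; exact: epi_comp.
have [p1 ip1] : exists p1, i ∘ p1 = p ∘ j.
  by apply: (ker_lift ki); rewrite compA; case: kj.
have [k1 jk1] : exists k1, j ∘ k1 = k.
  by apply: (ker_lift kj); rewrite -compA (proj1 kk) comp0r.
have [|g1 g1k] := x1 K F1 k1 p1 _ f; last first.
  have [g gj] := x2 _ _ _ _ sj g1.
  by exists g; rewrite -jk1 compA gj.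
split.
  apply/kerP; split.
  - by apply: (ker_mono ki); rewrite compA ip1 -compA jk1 (proj1 kk) comp0r.
  - by apply: (@mono_comp_r _ _ _ _ j); rewrite jk1; exact: ker_mono kk.
  move=> T t p1t; have [|s ks] := ker_lift kk (t := j ∘ t).
    by rewrite compA -ip1 -compA p1t comp0r.
  by exists s; apply: (ker_mono kj); rewrite compA jk1.
have [T [e [t [ee et]]]] := epi_lift abA i ep.
have [s js] : exists s, j ∘ s = t.
  by apply: (ker_lift kj); rewrite -compA et compA (proj1 ki) comp0l.
apply: (@epi_comp_l _ _ _ _ _ s); suff -> : p1 ∘ s = e by [].
by apply: (ker_mono ki); rewrite compA ip1 -compA js et.
Qed.

Lemma ext1_retract X X' Y (i : hom X' X) (r : hom X X') :
  r ∘ i = idm X' -> ext1 X Y -> ext1 X' Y.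
Proof.
move=> ri xXY K F k p kp f.
have [H [h1 [h2 [k' [c h1k sk _ lH]]]]] := pullback_ses abA r kp.
have [g gk] := xXY _ _ _ _ sk f.
have [|t [h1t h2t]] := lH F (idm F) (i ∘ p).
  by rewrite comp1r compA ri comp1l.
exists (g ∘ t); rewrite -gk -compA; congr (_ ∘ _).
(* [t ∘ k] and [k'] differ by a map into the kernel of [h2], and [h1] shows this map to be zero. *)
have -> : t ∘ k = k' + (t ∘ k - k') by rewrite addrC subrK.
have [|s' ks'] := ker_lift (proj1 sk) (t := t ∘ k - k').
  by rewrite compBr compA h2t (proj1 (proj1 sk)) subr0 -compA (proj1 (proj1 kp)) comp0r.
suff -> : t ∘ k - k' = 0 by rewrite addr0.
rewrite -ks'; suff -> : s' = 0 by rewrite comp0r.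
apply: (proj1 (mono0P k) (ker_mono (proj1 kp))); rewrite -h1k -compA ks' compBr.
by rewrite compA h1t comp1l h1k subrr.
Qed.

Lemma ext1_sum X1 X2 X Y : is_direct_sum X1 X2 X ->
  ext1 X Y <-> ext1 X1 Y /\ ext1 X2 Y.
Proof.
move=> [i1 [i2 [p1 [p2 [p11 p22 p12 p21 ip]]]]]; split=> [x|[x1 x2]].
  by split; [exact: ext1_retract p11 x|exact: ext1_retract p22 x].
exact: ext1_extl (ses_split_sum p21 p22 ip p11) x1 x2.
Qed.

Lemma ext1_sumr X Y1 Y2 Y : is_direct_sum Y1 Y2 Y ->
  ext1 X Y <-> ext1 X Y1 /\ ext1 X Y2.
Proof.
move=> [i1 [i2 [p1 [p2 [p11 p22 p12 p21 ip]]]]]; split=> [x|[x1 x2]].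
  split=> K E k p kp f.
    have [g gk] := x _ _ _ _ kp (i1 ∘ f); exists (p1 ∘ g).
    by rewrite -compA gk compA p11 comp1l.
  have [g gk] := x _ _ _ _ kp (i2 ∘ f); exists (p2 ∘ g).
  by rewrite -compA gk compA p22 comp1l.
move=> K E k p kp f.
have [g1 g1k] := x1 _ _ _ _ kp (p1 ∘ f); have [g2 g2k] := x2 _ _ _ _ kp (p2 ∘ f).
exists (i1 ∘ g1 + i2 ∘ g2).
by rewrite compDl -!compA g1k g2k !compA -compDl ip comp1l.
Qed.

Lemma ext1_zero X O : is_zero O -> ext1 X O.
Proof. by move=> zO K E k p _ f; exists 0; rewrite comp0l (zero_hom_r zO f). Qed.

Hypothesis projA : enough_projectives A.

Lemma proj_ses X : exists (P K : A) (k : hom K P) (p : hom P X),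
  projective P /\ ses k p.
Proof.
have [P [p [prP ep]]] := projA X; have [K [k kp]] := ker_ex abA p.
by exists P, K, k, p.
Qed.

(** On a projective presentation the extension of [q ∘ f] lifts through [q], since [P] is
    projective; the remaining error takes values in [R1]. *)
Lemma ext1_extr X R1 R R2 (i : hom R1 R) (q : hom R R2) :
  ses i q -> ext1 X R1 -> ext1 X R2 -> ext1 X R.
Proof.
move=> [ki eq] x1 x2; have [P [K [k [p [prP kp]]]]] := proj_ses X.
apply: (ext1_of_proj prP kp) => f.
have [g gk] := x2 _ _ _ _ kp (q ∘ f).
have [l ql] := prP _ _ _ g eq.
have [|d id'] := ker_lift ki (t := f - l ∘ k).
  by rewrite compBr compA ql gk subrr.
have [g' g'k] := x1 _ _ _ _ kp d.
by exists (i ∘ g' + l); rewrite compDl -compA g'k id' subrK.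
Qed.

(** A single type of presentations, so that a choice of one for every object can be iterated into a
    resolution. *)
Record syzygy (X : A) := Syzygy {
  syz_proj : A;
  syz_ker : A;
  syz_incl : hom syz_ker syz_proj;
  syz_cover : hom syz_proj X;
  syz_projP : projective syz_proj;
  syz_ses : ses syz_incl syz_cover }.

Lemma syzygy_ex X : inhabited (syzygy X).
Proof.
have [P [K [k [p [prP kp]]]]] := proj_ses X.
exact: (inhabits (Syzygy prP kp)).
Qed.

Lemma resolution_ex X : inhabited (proj_resolution X).
Proof.
have ch (Z : A) : syzygy Z.
  by apply: (proj1_sig (boolp.cid (P := fun=> True) _)); case: (syzygy_ex Z) => s; exists s.
(* [om n] is the n-th syzygy of [X]; its chosen projective cover is the term of degree n. *)
pose om := fix om n : A := if n is m.+1 then syz_ker (ch (om m)) else X.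
pose d n : hom (syz_proj (ch (om n.+1))) (syz_proj (ch (om n))) :=
  syz_incl (ch (om n)) ∘ syz_cover (ch (om n.+1)).
split; apply: (@ProjResolution A X (fun n => syz_proj (ch (om n))) d (syz_cover (ch X))).
- by move=> n; exact: syz_projP.
- by case: (syz_ses (ch X)).
- exists (om 1), (syz_incl (ch X)), (syz_cover (ch (om 1))).
  by split=> //; [case: (syz_ses (ch X))|case: (syz_ses (ch (om 1)))].
move=> n; exists (om n.+2), (syz_incl (ch (om n.+1))), (syz_cover (ch (om n.+2))).
split=> //; last by case: (syz_ses (ch (om n.+2))).
apply: ker_monol; first exact: ker_mono (proj1 (syz_ses _)).
by case: (syz_ses (ch (om n.+1))).
Qed.

(** In a resolution spliced from [p] and a resolution of [K], the map [f ∘ res_aug Q] is a cocycle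
    of degree 1, and a bounding cochain extends [f]. Conversely a cocycle of degree 1 descends to
    the first syzygy, where [ext1] applies. *)
Lemma Ext1P X Y : Ext_zero 1 X Y <-> ext1 X Y.
Proof.
split=> [/Ext_zeroP h|h].
  have [P [K [k [p [prP kp]]]]] := proj_ses X.
  apply: (ext1_of_proj prP kp) => f; have [Q] := resolution_ex K.
  have [aug0 _] := proj1 (exactP abA _ _) (res_exact0 Q).
  have [|g fg] := h (splice kp prP Q) (f ∘ res_aug Q).
    by rewrite /= -compA aug0 // comp0r.
  by exists g; apply: (@res_aug_epi _ _ Q); rewrite fg !compA.
apply/Ext_zeroP => P f fd.
have [K [k [e [kP ee ke]]]] := res_exact0 P.
have [K' [k' [e' [kk' ee' ke']]]] := tail_exact0 kP ke.
have [|f' f'e] := coker_desc (coker_epir ee' (epi_coker abA ee kk')) (t := f).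
  by rewrite ke'.
have [g gk] := h _ _ k (res_aug P) (conj kP (@res_aug_epi _ _ P)) f'.
by exists g; rewrite -ke compA gk.
Qed.

Lemma Ext_zero_syzygy n X Y K P (k : hom K P) (p : hom P X) :
  projective P -> ses k p -> Ext_zero n.+2 X Y -> Ext_zero n.+1 K Y.
Proof.
move=> prP kp /Ext_zeroP h; apply/Ext_zeroP => Q f fd.
by have [|g ->] := h (splice kp prP Q) f; [|exists g].
Qed.

(** Dimension shift: a cocycle of degree n+2 on [P] is a cocycle of degree n+1 on the tail of [P],
    which resolves a syzygy that is again in [L]. *)
Lemma hereditary_of_syzygies (L R : A -> Prop) :
  (forall X Y, L X -> R Y -> ext1 X Y) ->
  (forall X K P (k : hom K P) (p : hom P X), projective P -> ses k p -> L X -> L K) ->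
  hereditary_pair L R.
Proof.
move=> h1 hs [//|n] X Y _ LX RY; elim: n X LX => [|n IHn] X LX; first exact/Ext1P/h1.
apply/Ext_zeroP => P f fd; have [K [k [e [kP ee ke]]]] := res_exact0 P.
have LK : L K.
  by apply: (hs _ _ _ k (res_aug P)) LX => //; [exact: res_projective|split=> //; exact: res_aug_epi].
exact: (proj1 (Ext_zeroP _ _ _) (IHn K LK) (tail kP ee ke) f fd).
Qed.

(* Heredity enters only as closure of the left class under syzygies. *)
Record cotorsion (L R : A -> Prop) : Prop := Cotorsion {
  cot_left : forall X, L X <-> forall Y, R Y -> ext1 X Y;
  cot_right : forall Y, R Y <-> forall X, L X -> ext1 X Y;
  cot_cover : forall X, exists (R0 L0 : A) (f : hom R0 L0) (g : hom L0 X),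
    [/\ L L0, R R0 & ses f g];
  cot_envelope : forall X, exists (R1 L1 : A) (f : hom X R1) (g : hom R1 L1),
    [/\ L L1, R R1 & ses f g];
  cot_syzygy : forall X K P (k : hom K P) (p : hom P X),
    projective P -> ses k p -> L X -> L K }.

Lemma left_perpP (R : A -> Prop) X :
  left_perp R X <-> forall Y, R Y -> ext1 X Y.
Proof. by split=> h Y RY; apply/Ext1P; apply: h. Qed.

Lemma right_perpP (L : A -> Prop) Y :
  right_perp L Y <-> forall X, L X -> ext1 X Y.
Proof. by split=> h X LX; apply/Ext1P; apply: h. Qed.

Lemma cotorsionP (L R : A -> Prop) :
  hereditary_complete_cotorsion_pair L R <-> cotorsion L R.
Proof.
split=> [[[hL hR] cp her]|[hL hR c e s]].
  split.
  - by move=> X; rewrite hL; exact: left_perpP.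
  - by move=> X; rewrite hR; exact: right_perpP.
  - move=> X; have [[R0 [L0 [f [g [? ? /(short_exactP abA) ?]]]]] _] := cp X.
    by exists R0, L0, f, g.
  - move=> X; have [_ [R0 [L0 [f [g [? ? /(short_exactP abA) ?]]]]]] := cp X.
    by exists R0, L0, f, g.
  move=> X K P k p prP kp LX; apply/hL => Y RY.
  exact: (Ext_zero_syzygy prP kp (her 2 X Y isT LX RY)).
split.
- split=> X; first by rewrite hL left_perpP.
  by rewrite hR right_perpP.
- move=> X; split.
    have [R0 [L0 [f [g [? ? ?]]]]] := c X.
    by exists R0, L0, f, g; split=> //; apply/short_exactP.
  have [R0 [L0 [f [g [? ? ?]]]]] := e X.
  by exists R0, L0, f, g; split=> //; apply/short_exactP.
apply: hereditary_of_syzygies => // X Y LX RY; exact: (proj1 (hL X) LX).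
Qed.

End ExtZero.

(** * The comma category *)

Lemma projective_sum (A : preadditive) (P Q B : A) :
  is_direct_sum P Q B -> projective P -> projective Q -> projective B.
Proof.
move=> [i1 [i2 [p1 [p2 [_ _ _ _ ip]]]]] prP prQ X Y e f ee.
have [g eg] := prP _ _ e (f ∘ i1) ee; have [h eh] := prQ _ _ e (f ∘ i2) ee.
exists (g ∘ p1 + h ∘ p2).
by rewrite compDr !compA eg eh -!compA -compDr ip comp1r.
Qed.

Section Comma.
Variables (C D : preadditive) (G : additive_functor C D).
Implicit Types Z W : comma G.

Lemma comma_eta Z : CommaOb (comma_map Z) = Z :> comma G.
Proof. by case: Z. Qed.

Definition hsrc Z W (f : hom Z W) : hom (comma_src Z) (comma_src W) :=
  (comma_val f).1.
Definition htgt Z W (f : hom Z W) : hom (comma_tgt Z) (comma_tgt W) :=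
  (comma_val f).2.

Lemma comma_homP Z W (f : hom Z W) :
  comma_map W ∘ amap G (hsrc f) = htgt f ∘ comma_map Z.
Proof. by case: f => [[a b] h]; have := h; rewrite unfold_in => /eqP. Qed.

Lemma comma_hom_subproof Z W (a : hom (comma_src Z) (comma_src W))
    (b : hom (comma_tgt Z) (comma_tgt W)) :
  comma_map W ∘ amap G a = b ∘ comma_map Z -> (a, b) \in @comma_pred _ _ G Z W.
Proof. by move=> h; rewrite unfold_in; apply/eqP. Qed.

Definition comma_mk Z W (a : hom (comma_src Z) (comma_src W))
    (b : hom (comma_tgt Z) (comma_tgt W))
    (h : comma_map W ∘ amap G a = b ∘ comma_map Z) : hom Z W :=
  CommaHom (comma_hom_subproof h).

Lemma comma_eqP Z W (f g : hom Z W) : hsrc f = hsrc g -> htgt f = htgt g -> f = g.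
Proof. exact: comma_hom_eq. Qed.

Lemma hsrc_eq Z W (f g : hom Z W) : f = g -> hsrc f = hsrc g.
Proof. by move->. Qed.

Lemma htgt_eq Z W (f g : hom Z W) : f = g -> htgt f = htgt g.
Proof. by move->. Qed.

Lemma hsrc_mk Z W a b h : hsrc (@comma_mk Z W a b h) = a. Proof. by []. Qed.
Lemma htgt_mk Z W a b h : htgt (@comma_mk Z W a b h) = b. Proof. by []. Qed.

Lemma hsrcM Z1 Z2 Z3 (g : hom Z2 Z3) (f : hom Z1 Z2) :
  hsrc (g ∘ f) = hsrc g ∘ hsrc f.
Proof. by []. Qed.

Lemma htgtM Z1 Z2 Z3 (g : hom Z2 Z3) (f : hom Z1 Z2) :
  htgt (g ∘ f) = htgt g ∘ htgt f.
Proof. by []. Qed.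

Lemma hsrcD Z W (f g : hom Z W) : hsrc (f + g) = hsrc f + hsrc g.
Proof. by rewrite /hsrc comma_valD. Qed.

Lemma htgtD Z W (f g : hom Z W) : htgt (f + g) = htgt f + htgt g.
Proof. by rewrite /htgt comma_valD. Qed.

Lemma hsrc0 Z W : hsrc (0 : hom Z W) = 0.
Proof. by apply: (addrI (hsrc 0)); rewrite -hsrcD !addr0. Qed.

Lemma htgt0 Z W : htgt (0 : hom Z W) = 0.
Proof. by apply: (addrI (htgt 0)); rewrite -htgtD !addr0. Qed.

Lemma hsrcB Z W (f g : hom Z W) : hsrc (f - g) = hsrc f - hsrc g.
Proof. by apply: (addIr (hsrc g)); rewrite -hsrcD !subrK. Qed.

Lemma htgtB Z W (f g : hom Z W) : htgt (f - g) = htgt f - htgt g.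
Proof. by apply: (addIr (htgt g)); rewrite -htgtD !subrK. Qed.

Lemma diag_hom_subproof U Z (a : hom U (comma_src Z)) :
  comma_map Z ∘ amap G a = (comma_map Z ∘ amap G a) ∘ idm (G U).
Proof. by rewrite comp1r. Qed.

(** Together with [diag_hom_eq] this says that [comma_diag G] is left adjoint to the source
    projection. *)
Definition diag_hom U Z (a : hom U (comma_src Z)) : hom (comma_diag G U) Z :=
  @comma_mk (comma_diag G U) Z a _ (diag_hom_subproof a).

Lemma hsrc_diag U Z (a : hom U (comma_src Z)) : hsrc (diag_hom a) = a.
Proof. by []. Qed.

Lemma diag_homE U Z (f : hom (comma_diag G U) Z) :
  htgt f = comma_map Z ∘ amap G (hsrc f).
Proof. by rewrite comma_homP comp1r. Qed.

Lemma diag_hom_eq U Z (f g : hom (comma_diag G U) Z) : hsrc f = hsrc g -> f = g.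
Proof. by move=> e; apply: comma_eqP => //; rewrite !diag_homE e. Qed.

Section ZeroSource.
Variables (O : C) (zO : is_zero O).

Lemma czero_hom_subproof V Z (b : hom V (comma_tgt Z)) :
  comma_map Z ∘ amap G (0 : hom O (comma_src Z)) = b ∘ 0.
Proof. by rewrite amap0 !comp0r. Qed.

(** Likewise [V] |-> (0, V)_0 is left adjoint to the target projection. *)
Definition czero_hom V Z (b : hom V (comma_tgt Z)) : hom (comma_zero G O V) Z :=
  @comma_mk (comma_zero G O V) Z 0 b (czero_hom_subproof b).

Lemma htgt_czero V Z (b : hom V (comma_tgt Z)) : htgt (czero_hom b) = b.
Proof. by []. Qed.

Lemma czero_hom_eq V Z (f g : hom (comma_zero G O V) Z) : htgt f = htgt g -> f = g.
Proof.
by move=> e; apply: comma_eqP => //; rewrite (zero_hom_l zO (hsrc f)) (zero_hom_l zO (hsrc g)).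
Qed.

Lemma to_czero_subproof V Z (b : hom (comma_tgt Z) V) : b ∘ comma_map Z = 0 ->
  (0 : hom (G O) V) ∘ amap G (0 : hom (comma_src Z) O) = b ∘ comma_map Z.
Proof. by move=> ->; rewrite comp0l. Qed.

(** Maps into (0, V)_0 are maps out of the cokernel of [comma_map Z]: the cokernel is left adjoint
    to [V] |-> (0, V)_0. *)
Definition to_czero V Z (b : hom (comma_tgt Z) V) (h : b ∘ comma_map Z = 0) :
    hom Z (comma_zero G O V) :=
  @comma_mk Z (comma_zero G O V) 0 b (to_czero_subproof h).

Lemma htgt_to_czero V Z (b : hom (comma_tgt Z) V) (h : b ∘ comma_map Z = 0) :
  htgt (to_czero h) = b.
Proof. by []. Qed.

Lemma to_czeroE V Z (f : hom Z (comma_zero G O V)) : htgt f ∘ comma_map Z = 0.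
Proof. by rewrite -comma_homP /= comp0l. Qed.

(* [(T, G T)_1] and [(0, T)_0] detect the two components of a morphism. *)
Lemma comma_monoP Z W (f : hom Z W) : mono f <-> mono (hsrc f) /\ mono (htgt f).
Proof.
split=> [/mono0P mf|[/mono0P m1 /mono0P m2]]; last first.
  apply/mono0P => T t ft; apply: comma_eqP; rewrite ?hsrc0 ?htgt0.
    by apply: m1; rewrite -hsrcM ft hsrc0.
  by apply: m2; rewrite -htgtM ft htgt0.
split; apply/mono0P => T t ft.
  have := mf _ (diag_hom t); rewrite -[t]hsrc_diag => ->.
    by rewrite hsrc0.
  by apply: diag_hom_eq; rewrite hsrc0 hsrcM.
have := mf _ (czero_hom t); rewrite -[t]htgt_czero => ->.
  by rewrite htgt0.
by apply: czero_hom_eq; rewrite htgt0 htgtM.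
Qed.

Lemma comma_kerP Z W K (f : hom Z W) (k : hom K Z) :
  is_kernel f k <-> is_kernel (hsrc f) (hsrc k) /\ is_kernel (htgt f) (htgt k).
Proof.
split=> [/kerP[fk /comma_monoP[m1 m2] lk]|[/kerP[fk1 m1 l1] /kerP[fk2 m2 l2]]]; last first.
  apply/kerP; split.
  - by apply: comma_eqP; rewrite ?hsrc0 ?htgt0.
  - exact/comma_monoP.
  move=> T t ft; have [|s1 ks1] := l1 _ (hsrc t); first by rewrite -hsrcM ft hsrc0.
  have [|s2 ks2] := l2 _ (htgt t); first by rewrite -htgtM ft htgt0.
  have h : comma_map K ∘ amap G s1 = s2 ∘ comma_map T.
    apply: m2; rewrite !compA -comma_homP ks2 -compA -amapM ks1.
    by rewrite comma_homP.
  by exists (comma_mk h); apply: comma_eqP.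
split; apply/kerP; split=> //.
- by rewrite -hsrcM fk hsrc0.
- move=> T t ft; have [|s ks] := lk _ (diag_hom t).
    by apply: diag_hom_eq; rewrite hsrc0 hsrcM.
  by exists (hsrc s); rewrite -[RHS](hsrc_diag t) -ks.
- by rewrite -htgtM fk htgt0.
- move=> T t ft; have [|s ks] := lk _ (czero_hom t).
    by apply: czero_hom_eq; rewrite htgt0 htgtM.
  by exists (htgt s); rewrite -[RHS](htgt_czero t) -ks.
Qed.

End ZeroSource.

Lemma diag_czero_sum O U V B i1 i2 p1 p2 : is_zero O ->
  [/\ p1 ∘ i1 = idm (G U), p2 ∘ i2 = idm V, p1 ∘ i2 = 0, p2 ∘ i1 = 0
      & i1 ∘ p1 + i2 ∘ p2 = idm B] ->
  is_direct_sum (comma_diag G U) (comma_zero G O V) (CommaOb i1 : comma G).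
Proof.
move=> zO [p11 p22 p12 p21 ip].
have h1 : comma_map (comma_diag G U) ∘ amap G (idm U) = p1 ∘ i1 by rewrite amap1 comp1r p11.
exists (diag_hom (Z := CommaOb i1 : comma G) (idm U)), (czero_hom O (Z := CommaOb i1 : comma G) i2).
exists (@comma_mk (CommaOb i1) _ _ _ h1), (to_czero O (Z := CommaOb i1 : comma G) p21).
split; apply: comma_eqP; rewrite ?hsrcD ?htgtD ?hsrc0 ?htgt0 ?hsrcM ?htgtM /= ?hsrc_mk ?htgt_mk
  ?amap1 ?comp1r ?comp0l ?comp0r ?addr0 //.
by rewrite [RHS](zero_hom_l zO).
Qed.

(** * The comma category is abelian with enough projectives *)

Section Abelian.
Hypotheses (abC : abelian C) (abD : abelian D) (rG : right_exact G).

Lemma amap_epi X Y (e : hom X Y) : epi e -> epi (amap G e).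
Proof.
by move=> ee; have [K [k ke]] := epi_ses abC ee; case: (rG (proj2 (short_exactP abC _ _) ke)).
Qed.

(** Right exactness is stated for short exact sequences only. With [f = m ∘ e], the maps [m] and [f]
    have the same cokernel, and the epi [amap G e] does not change it after applying G. *)
Lemma amap_coker X Y Q (f : hom X Y) (c : hom Y Q) :
  is_cokernel f c -> is_cokernel (amap G f) (amap G c).
Proof.
move=> cf; have [I [e [m [ee mm me]]]] := epi_mono_factor abC f.
have cm : is_cokernel m c.
  apply/cokerP; split; [|exact: coker_epi cf|].
    by apply: (proj1 (epi0P e) ee); rewrite -compA me; case: cf.
  by move=> T t tm; apply: (coker_desc cf); rewrite -me compA tm comp0l.
have smc : ses m c by split; [exact: mono_ker mm cm|exact: coker_epi cf].
have [[K [k [e' [kk ee' ke']]]] eGc] := rG (proj2 (short_exactP abC _ _) smc).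
rewrite -me amapM -ke'; apply: coker_epir; first exact: amap_epi.
by apply: coker_epir => //; exact: epi_coker eGc kk.
Qed.

(** A test map on sources is a morphism into (T, 0). A test map [t] on targets becomes a morphism
    into (0, T) because it kills [comma_map W], which is checked after the epi [amap G (hsrc f)]. *)
Lemma comma_epiP Z W (f : hom Z W) : epi f <-> epi (hsrc f) /\ epi (htgt f).
Proof.
have [OC zOC] := zero_ob abC; have [OD zOD] := zero_ob abD.
split=> [/epi0P ef|[/epi0P e1 /epi0P e2]]; last first.
  apply/epi0P => T t ft; apply: comma_eqP; rewrite ?hsrc0 ?htgt0.
    by apply: e1; rewrite -hsrcM ft hsrc0.
  by apply: e2; rewrite -htgtM ft htgt0.
have e1 : epi (hsrc f).
  apply/epi0P => T t tf.
  have h : comma_map (CommaOb (0 : hom (G T) OD) : comma G) ∘ amap G t = 0 ∘ comma_map W.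
    by rewrite /= !comp0l.
  rewrite -(hsrc_mk h); have -> := ef _ (comma_mk h); first by rewrite hsrc0.
  by apply: comma_eqP; rewrite ?hsrc0 ?htgt0 ?hsrcM ?htgtM // htgt_mk comp0l.
split=> //; apply/epi0P => T t tf.
have h : t ∘ comma_map W = 0.
  apply: (proj1 (epi0P _) (amap_epi e1)).
  by rewrite -compA comma_homP compA tf comp0l.
rewrite -(htgt_to_czero OC h); have -> := ef _ (to_czero OC h); first by rewrite htgt0.
by apply: comma_eqP; rewrite ?hsrc0 ?htgt0 ?hsrcM ?htgtM ?hsrc_mk // comp0l.
Qed.

Lemma comma_sesP (X Y Z : comma G) (f : hom X Y) (g : hom Y Z) :
  ses f g <-> ses (hsrc f) (hsrc g) /\ ses (htgt f) (htgt g).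
Proof.
have [OC zOC] := zero_ob abC.
split=> [[/(comma_kerP zOC)[? ?] /comma_epiP[? ?]] //|[[? ?] [? ?]]].
by split; [apply/(comma_kerP zOC)|apply/comma_epiP].
Qed.

Lemma comma_coker_intro Z W Q (f : hom Z W) (c : hom W Q) :
  is_cokernel (hsrc f) (hsrc c) -> is_cokernel (htgt f) (htgt c) -> is_cokernel f c.
Proof.
move=> c1 c2; apply/cokerP; split.
- by apply: comma_eqP; rewrite ?hsrc0 ?htgt0 ?hsrcM ?htgtM ?(proj1 c1) ?(proj1 c2).
- by apply/comma_epiP; split; [exact: coker_epi c1|exact: coker_epi c2].
move=> T t tf; have [|s1 ks1] := coker_desc c1 (t := hsrc t); first by rewrite -hsrcM tf hsrc0.
have [|s2 ks2] := coker_desc c2 (t := htgt t); first by rewrite -htgtM tf htgt0.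
have h : comma_map T ∘ amap G s1 = s2 ∘ comma_map Q.
  apply: (amap_epi (coker_epi c1)); rewrite -compA -amapM ks1 comma_homP.
  by rewrite -compA comma_homP compA ks2.
by exists (comma_mk h); apply: comma_eqP.
Qed.

Lemma comma_abelian : abelian (comma G).
Proof.
have [OC zOC] := zero_ob abC; have [OD zOD] := zero_ob abD.
have kex (X Y : comma G) (f : hom X Y) : exists (K : comma G) (k : hom K X), is_kernel f k.
  have [K1 [k1 kk1]] := ker_ex abC (hsrc f); have [K2 [k2 kk2]] := ker_ex abD (htgt f).
  (* The structure map of the kernel is induced by the kernel in [D]; that of the cokernel, below,
     exists because G preserves cokernels. *)
  have [|m km] := ker_lift kk2 (t := comma_map X ∘ amap G k1).
    by rewrite compA -comma_homP -compA -amapM (proj1 kk1) amap0 comp0r.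
  exists (CommaOb m : comma G), (@comma_mk (CommaOb m : comma G) _ k1 k2 (esym km)).
  exact/(comma_kerP zOC).
have cex (X Y : comma G) (f : hom X Y) : exists (Q : comma G) (c : hom Y Q),
    is_cokernel (hsrc f) (hsrc c) /\ is_cokernel (htgt f) (htgt c).
  have [Q1 [c1 cc1]] := coker_ex abC (hsrc f); have [Q2 [c2 cc2]] := coker_ex abD (htgt f).
  have [|m mc] := coker_desc (amap_coker cc1) (t := c2 ∘ comma_map Y).
    by rewrite -compA comma_homP compA (proj1 cc2) comp0l.
  by exists (CommaOb m : comma G), (@comma_mk _ (CommaOb m : comma G) c1 c2 mc).
split.
- exists (CommaOb (0 : hom (G OC) OD)) => Z; split=> f; apply: comma_eqP.
  + exact: (zero_hom_l zOC). + exact: (zero_hom_l zOD).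
  + exact: (zero_hom_r zOC). + exact: (zero_hom_r zOD).
- move=> X Y; have [B1 [i1 [i2 [p1 [p2 [p11 p22 p12 p21 ip]]]]]] := sum_ob abC (comma_src X) (comma_src Y).
  have [B2 [j1 [j2 [q1 [q2 [q11 q22 q12 q21 jq]]]]]] := sum_ob abD (comma_tgt X) (comma_tgt Y).
  pose m := j1 ∘ comma_map X ∘ amap G p1 + j2 ∘ comma_map Y ∘ amap G p2.
  pose B : comma G := CommaOb m.
  have h1 : m ∘ amap G i1 = j1 ∘ comma_map X.
    by rewrite /m compDl -!compA -!amapM p11 p21 amap0 amap1 !comp0r comp1r addr0.
  have h2 : m ∘ amap G i2 = j2 ∘ comma_map Y.
    by rewrite /m compDl -!compA -!amapM p12 p22 amap0 amap1 !comp0r comp1r add0r.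
  have h3 : comma_map X ∘ amap G p1 = q1 ∘ m.
    by rewrite /m compDr !compA q11 q12 !comp0l comp1l addr0.
  have h4 : comma_map Y ∘ amap G p2 = q2 ∘ m.
    by rewrite /m compDr !compA q21 q22 !comp0l comp1l add0r.
  exists B, (@comma_mk X B _ _ h1), (@comma_mk Y B _ _ h2), (@comma_mk B X _ _ h3), (@comma_mk B Y _ _ h4).
  by split; apply: comma_eqP; rewrite ?hsrcD ?htgtD ?hsrc0 ?htgt0 ?hsrcM ?htgtM ?hsrc_mk ?htgt_mk.
- move=> X Y f; split; first exact: kex.
  by have [Q [c [c1 c2]]] := cex _ _ f; exists Q, c; apply: comma_coker_intro.
- move=> X Y f /(comma_monoP zOC)[m1 m2]; have [Q [c [c1 c2]]] := cex _ _ f.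
  by exists Q, c; apply/(comma_kerP zOC); split; exact: mono_ker.
- move=> X Y f /comma_epiP[e1 e2]; have [K [k /(comma_kerP zOC)[k1 k2]]] := kex _ _ f.
  by exists K, k; apply: comma_coker_intro; exact: epi_coker.
Qed.

Lemma projective_diag P : projective P -> projective (comma_diag G P).
Proof.
move=> prP X Y e f /comma_epiP[e1 _]; have [g eg] := prP _ _ (hsrc e) (hsrc f) e1.
by exists (diag_hom g); apply: diag_hom_eq.
Qed.

Lemma projective_czero O Q : is_zero O -> projective Q -> projective (comma_zero G O Q).
Proof.
move=> zO prQ X Y e f /comma_epiP[_ e2]; have [g eg] := prQ _ _ (htgt e) (htgt f) e2.
by exists (czero_hom O g); apply: (czero_hom_eq zO).
Qed.

Lemma comma_enough_projectives :
  enough_projectives C -> enough_projectives D -> enough_projectives (comma G).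
Proof.
move=> pC pD Z; have [OC zOC] := zero_ob abC.
have [P [p [prP ep]]] := pC (comma_src Z); have [Q [q [prQ eq]]] := pD (comma_tgt Z).
have [B [i1 [i2 [p1 [p2 e]]]]] := sum_ob abD (G P) Q.
have [p11 p22 p12 p21 ip] := e.
have h : comma_map Z ∘ amap G p = (comma_map Z ∘ amap G p ∘ p1 + q ∘ p2) ∘ i1.
  by rewrite compDl -!compA p11 p21 comp0r comp1r addr0.
exists (CommaOb i1 : comma G), (@comma_mk (CommaOb i1) Z p _ h); split.
  apply: projective_sum (diag_czero_sum zOC e) _ _; first exact: projective_diag.
  exact: projective_czero.
apply/comma_epiP; split=> //=; apply: (@epi_comp_l _ _ _ _ _ i2).
by rewrite htgt_mk compDl -!compA p12 p22 !comp0r comp1r add0r.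
Qed.

End Abelian.
End Comma.

(** * The cotorsion pair in the comma category *)

Section CotorsionClasses.
Variables (A : preadditive) (abA : abelian A) (projA : enough_projectives A).
Variables (L R : A -> Prop) (cot : cotorsion L R).

Lemma cot_ext1 X Y : L X -> R Y -> ext1 X Y.
Proof. by move=> LX RY; exact: (proj1 (cot_left cot X)). Qed.

Lemma left_zero O : is_zero O -> L O.
Proof.
move=> zO; apply/(cot_left cot) => Y _; apply: (ext1_proj abA).
by move=> X Z e f _; exists 0; rewrite (zero_hom_l zO f) comp0r.
Qed.

Lemma right_zero O : is_zero O -> R O.
Proof. by move=> zO; apply/(cot_right cot) => Y _; exact: ext1_zero. Qed.

Lemma left_sum X1 X2 X : is_direct_sum X1 X2 X -> L X <-> L X1 /\ L X2.
Proof.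
move=> s; split=> [LX|[L1 L2]].
  by split; apply/(cot_left cot) => Y RY; have /(ext1_sum abA _ s)[] := cot_ext1 LX RY.
by apply/(cot_left cot) => Y RY; apply/(ext1_sum abA _ s); split; exact: cot_ext1.
Qed.

Lemma right_sum X1 X2 X : is_direct_sum X1 X2 X -> R X <-> R X1 /\ R X2.
Proof.
move=> s; split=> [LX|[L1 L2]].
  by split; apply/(cot_right cot) => Y RY; have /(ext1_sumr _ s)[] := cot_ext1 RY LX.
by apply/(cot_right cot) => Y RY; apply/(ext1_sumr _ s); split; exact: cot_ext1.
Qed.

Lemma left_ext X1 X X2 (i : hom X1 X) (q : hom X X2) :
  ses i q -> L X1 -> L X2 -> L X.
Proof.
move=> s L1 L2; apply/(cot_left cot) => Y RY.
by apply: (ext1_extl abA s); exact: cot_ext1.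
Qed.

Lemma right_ext X1 X X2 (i : hom X1 X) (q : hom X X2) :
  ses i q -> R X1 -> R X2 -> R X.
Proof.
move=> s L1 L2; apply/(cot_right cot) => Y RY.
by apply: (ext1_extr abA projA s); exact: cot_ext1.
Qed.

End CotorsionClasses.

(** * Orthogonality, syzygies and approximations in the comma category *)

Section CommaCotorsion.
Variables (C D : preadditive) (abC : abelian C) (abD : abelian D).
Variables (projC : enough_projectives C) (projD : enough_projectives D).
Variables (G : additive_functor C D) (rG : right_exact G).

(** The kernel [N] of (P, G P) -> (A, G A) has as structure map the epi from [G K] onto the kernel
    of [amap G p]. A morphism out of [N] is thus determined on sources, where the extension problem
    is the one in [C]. *)
Lemma ext1_diag (A : C) (W : comma G) : ext1 A (comma_src W) -> ext1 (comma_diag G A) W.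
Proof.
move=> xA; have [P [K [k [p [prP kp]]]]] := proj_ses abC projC A.
have [[K2 [ka [e [kka ee kae]]]] eGp] := rG (proj2 (short_exactP abC _ _) kp).
pose N : comma G := CommaOb e.
have h : comma_map (comma_diag G P) ∘ amap G k = ka ∘ comma_map N.
  by rewrite comp1l kae.
apply: (@ext1_of_proj _ (comma_abelian abC abD rG) _ _ N _ (@comma_mk _ _ _ N (comma_diag G P) _ _ h)
  (diag_hom (Z := comma_diag G A) p)).
- exact: (projective_diag abC abD rG).
- by apply/(comma_sesP abC abD rG); split=> //; rewrite !htgt_mk (comp1l (amap G p)).
move=> f; have [g gk] := xA _ _ _ _ kp (hsrc f); exists (diag_hom g).
apply: comma_eqP => //; rewrite htgtM diag_homE hsrc_diag htgt_mk.
by apply: ee; rewrite -compA kae -compA -amapM gk; exact: (comma_homP f).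
Qed.

Lemma czero_ses OC (zOC : is_zero OC) V1 V2 V3 (f : hom V1 V2) (g : hom V2 V3) : ses f g ->
  ses (czero_hom OC (Z := comma_zero G OC V2) f) (czero_hom OC (Z := comma_zero G OC V3) g).
Proof.
move=> fg; apply/(comma_sesP abC abD rG); split=> //=; rewrite !hsrc_mk.
by rewrite -[X in ses _ X](zero_hom_l zOC (idm OC)); exact: ses_0id.
Qed.

Lemma ext1_czeroP OC (zOC : is_zero OC) (B : D) (W : comma G) :
  ext1 (comma_zero G OC B) W <-> ext1 B (comma_tgt W).
Proof.
split=> [x K E k p kp f|x].
  have [g gk] := x _ _ _ _ (czero_ses zOC kp) (czero_hom OC f).
  by exists (htgt g); exact: (htgt_eq gk).
have [P [K [k [p [prP kp]]]]] := proj_ses abD projD B.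
apply: (ext1_of_proj (comma_abelian abC abD rG) _ (czero_ses zOC kp)).
  exact: (projective_czero abC abD rG).
move=> f; have [g gk] := x _ _ _ _ kp (htgt f); exists (czero_hom OC g).
exact: (czero_hom_eq zOC).
Qed.


Variables (U X : C -> Prop) (V Y : D -> Prop).
Hypotheses (UX : cotorsion U X) (VY : cotorsion V Y).
Hypothesis L1G_U : forall A H, U A -> is_L1 G A H -> is_zero H.
Hypothesis G_U : forall A, U A -> Y (G A).

(** Splice the presentation with a resolution of [K]. An element of [G K] killed by [amap G k] lifts
    to degree 1 as a cycle of the complex; since L_1 G vanishes it is a boundary, and boundaries die
    in [G K]. *)
Lemma L1_zero_mono A K P (k : hom K P) (p : hom P A) :
  U A -> projective P -> ses k p -> mono (amap G k).
Proof.
move=> UA prP kp; have [Q] := resolution_ex abC projC K.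
pose R := splice kp prP Q.
have [dd0 _] := proj1 (exactP abC _ _) (res_exact R 0).
have [a0 _] := proj1 (exactP abC _ _) (res_exact0 Q).
have [N [n kn]] := ker_ex abD (amap G (res_d R 0)).
have [|e ne] := ker_lift kn (t := amap G (res_d R 1)).
  by rewrite -amapM dd0 amap0.
have [H [c ce]] := coker_ex abD e.
have zH : is_zero H by apply: (L1G_U UA); exists R, N, n, e, c.
have ee : epi e.
  apply/epi0P => T t te; have [s <-] := coker_desc ce te.
  by rewrite (zero_hom_r zH c) comp0r.
apply/mono0P => T t kt.
have [T1 [e1 [t1 [ee1 et1]]]] := epi_lift abD t (amap_epi abC rG (@res_aug_epi _ _ Q)).
have [|t2 nt2] := ker_lift kn (t := t1).
  by rewrite /= amapM -compA et1 compA kt comp0l.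
have [T2 [e2 [t3 [ee2 et3]]]] := epi_lift abD t2 ee.
apply: (proj1 (epi0P _) (epi_comp ee1 ee2)).
rewrite compA -et1 -nt2 -!compA -et3 (compA n) ne compA -amapM.
by rewrite [_ ∘ res_d R 1]a0 amap0 comp0l.
Qed.

(** The presentation case transfers to any sequence through 0 -> K0 -> K ⊕ P -> F -> 0. An element
    of [G K] dying in [G F] comes locally from [G K0]; its [P]-component vanishes, and [amap G k0]
    is mono, so it is zero. *)
Lemma amap_ses A K F (k : hom K F) (p : hom F A) :
  U A -> ses k p -> ses (amap G k) (amap G p).
Proof.
move=> UA kp; have [P [K0 [k0 [p0 [prP kp0]]]]] := proj_ses abC projC A.
have [l pl] := prP _ _ _ p0 (proj2 kp).
have [B [i1 [i2 [p1 [p2 e]]]]] := sum_ob abC K P.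
have [m [km sB]] := ses_cover abC kp kp0 pl e; have [p11 p22 p12 p21 ip] := e.
have mk0 := L1_zero_mono UA prP kp0.
have [xB _] := rG (proj2 (short_exactP abC _ _) sB).
have [_ lB] := proj1 (exactP abD _ _) xB.
have [xk ep] := rG (proj2 (short_exactP abC _ _) kp).
apply/(short_exactP abD); split=> //.
apply/mono0P => T t kt.
have [|T' [e' [s [ee' es]]]] := lB _ (amap G i1 ∘ t).
  rewrite compA -amapM compDl -!compA p11 p21 comp0r comp1r addr0 //.
have s0 : s = 0.
  apply: (proj1 (mono0P _) mk0); move: (congr1 (fun x => amap G p2 ∘ x) es).
  rewrite !compA -!amapM p21 amap0 !comp0l compBr !compA p21 p22 comp0l comp1l sub0r.
  by rewrite amapN compNl => /eqP; rewrite oppr_eq0 => /eqP.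
apply: (proj1 (epi0P _) ee').
move: (congr1 (fun x => amap G p1 ∘ x) es); rewrite s0 !comp0r.
by rewrite !compA -amapM p11 amap1 comp1l.
Qed.

Let XY : comma G -> Prop := comma_class (G := G) X Y.
Let L : comma G -> Prop := fun Z => forall W, XY W -> ext1 Z W.

Lemma left_diag A : U A -> L (comma_diag G A).
Proof. by move=> UA W [XW _]; apply: ext1_diag; exact: (cot_ext1 UX). Qed.

Lemma left_czero OC B : is_zero OC -> V B -> L (comma_zero G OC B).
Proof. by move=> zOC VB W [_ YW]; apply/(ext1_czeroP zOC); exact: (cot_ext1 VY). Qed.

Variables (OC : C) (zOC : is_zero OC) (OD : D) (zOD : is_zero OD).

(** [Z] is an extension of (0, Q)_0 by (A, G A)_1 with [A] its source, and left orthogonals are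
    closed under extensions. In this form membership can be checked by exactness alone, without
    exhibiting a splitting. *)
Lemma comma_left_intro (Z : comma G) Q (c : hom (comma_tgt Z) Q) :
  U (comma_src Z) -> ses (comma_map Z) c -> V Q -> L Z.
Proof.
move=> UZ sc VQ W XYW.
have c0 : c ∘ comma_map Z = 0 by case: sc => -[].
apply: (@ext1_extl _ (comma_abelian abC abD rG) _ _ _ _ (diag_hom (idm (comma_src Z))) (to_czero OC c0)).
- apply/(comma_sesP abC abD rG); rewrite hsrc_diag hsrc_mk htgt_mk /=.
  by rewrite htgt_mk amap1 comp1r; split=> //; exact: ses_id0.
- exact: left_diag.
exact: left_czero.
Qed.

Lemma comma_left_elim (Z : comma G) : L Z ->
  U (comma_src Z) /\ exists (Q : D) (i2 : hom Q (comma_tgt Z)) p1 p2,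
    V Q /\ [/\ p1 ∘ comma_map Z = idm _, p2 ∘ i2 = idm Q, p1 ∘ i2 = 0,
      p2 ∘ comma_map Z = 0 & comma_map Z ∘ p1 + i2 ∘ p2 = idm _].
Proof.
move=> LZ.
have UZ : U (comma_src Z).
  apply/(cot_left UX) => X' XX' K E k p kp f.
  (* An extension of the source by [K] is pulled back to an extension of [Z] by (K, 0) with the
     target of [Z] unchanged; the test object is (X', 0). *)
  pose N : comma G := CommaOb (0 : hom (G K) OD).
  pose M : comma G := CommaOb (comma_map Z ∘ amap G p).
  pose W : comma G := CommaOb (0 : hom (G X') OD).
  have hN : comma_map M ∘ amap G k = 0 ∘ comma_map N.
    by rewrite comp0r /= -compA -amapM (proj1 (proj1 kp)) amap0 comp0r.
  have hM : comma_map Z ∘ amap G p = idm _ ∘ comma_map M by rewrite comp1l.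
  have hf : comma_map W ∘ amap G f = 0 ∘ comma_map N by rewrite comp0r comp0l.
  have s : ses (@comma_mk _ _ _ N M _ _ hN) (@comma_mk _ _ _ M Z _ _ hM).
    by apply/(comma_sesP abC abD rG); split=> //; exact: ses_0id.
  have [|g gk] := LZ W _ _ _ _ _ s (@comma_mk _ _ _ N W _ _ hf).
    by split=> //; exact: (right_zero VY).
  by exists (hsrc g); exact: (hsrc_eq gk).
split=> //; set f := comma_map Z in LZ *.
have [r rf] : exists r, r ∘ f = idm _.
  have [B [i1 [i2 [p1 [p2 [p11 p22 p12 p21 ip]]]]]] := sum_ob abD (comma_tgt Z) (G (comma_src Z)).
  (* [M] has target B ⊕ G(A), with A and B the source and target of [Z], and structure map (f, 1). A
     morphism from [M] to (0, G A) must kill (f, 1); if it extends the identity of G(A), minus its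
     component on B is a retraction of [f]. *)
  pose M : comma G := CommaOb (i1 ∘ f + i2).
  have hM : comma_map Z ∘ amap G (idm _) = p1 ∘ comma_map M.
    by rewrite amap1 comp1r compDr compA p11 p12 comp1l addr0.
  have s : ses (czero_hom OC (Z := M) i2) (@comma_mk _ _ _ M Z _ _ hM).
    apply/(comma_sesP abC abD rG); split; first exact: ses_0id.
    by apply: (ses_split_sum (p1 := p2) (i2 := i1)) => //; rewrite addrC.
  have [|g gk] := LZ (comma_zero G OC (G (comma_src Z))) _ _ _ _ _ s (idm (comma_zero G OC _)).
    by split; [exact: (right_zero UX)|exact: G_U].
  have g2 : htgt g ∘ i2 = idm _ := htgt_eq gk.
  exists (- (htgt g ∘ i1)); have := to_czeroE g.
  rewrite compDr g2 compA => /eqP; rewrite addrC addr_eq0 => /eqP g1.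
  by rewrite compNl -g1.
have [Q [j [s e]]] := split_mono_sum abD rf; exists Q, j, r, s; split=> //.
apply/(cot_left VY) => Y' YY'.
have sZ : is_direct_sum (comma_diag G (comma_src Z)) (comma_zero G OC Q) Z.
  by rewrite -[X in is_direct_sum _ _ X]comma_eta; exact: (diag_czero_sum zOC e).
have : ext1 Z (comma_zero G OC Y').
  by apply: LZ; split=> //; exact: (right_zero UX).
by move/(ext1_sum (comma_abelian abC abD rG) _ sZ) => -[_ /(ext1_czeroP zOC)].
Qed.

Lemma comma_leftP Z : L Z <-> comma_sum_class (G := G) U V Z.
Proof.
split=> [/comma_left_elim[UZ [Q [j [r [s [VQ e]]]]]]|[A [O [B [UA VB zO s]]]] W XYW].
  exists (comma_src Z), OC, Q; split=> //.
  by rewrite -[X in is_direct_sum _ _ X]comma_eta; exact: (diag_czero_sum zOC e).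
by apply/(ext1_sum (comma_abelian abC abD rG) _ s); split; [exact: left_diag|exact: (left_czero zO)].
Qed.

(** The source projection is left adjoint to [E] |-> (E, 0), which preserves epis. *)
Lemma projective_src (P : comma G) : projective P -> projective (comma_src P).
Proof.
move=> prP E E' e f ee.
pose M := CommaOb (0 : hom (G E) OD) : comma G.
pose M' := CommaOb (0 : hom (G E') OD) : comma G.
have h : comma_map M' ∘ amap G e = 0 ∘ comma_map M by rewrite !comp0l.
have h' : comma_map M' ∘ amap G f = 0 ∘ comma_map P by rewrite !comp0l.
have [|g eg] := prP _ _ (@comma_mk _ _ _ M M' _ _ h) (@comma_mk _ _ _ P M' _ _ h').
  by apply/(comma_epiP abC abD rG); split=> //; apply/epi0P => T t _; exact: zero_hom_l.
by exists (hsrc g); exact: (hsrc_eq eg).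
Qed.

(** [Q] is a retract of the cokernel of [comma_map P], and the cokernel is left adjoint to [V] |->
    (0, V)_0, which preserves epis. *)
Lemma projective_coker_map (P : comma G) Q (i : hom Q (comma_tgt P))
    (p : hom (comma_tgt P) Q) :
  projective P -> p ∘ comma_map P = 0 -> p ∘ i = idm Q -> projective Q.
Proof.
move=> prP pf pi E E' e f ee.
have fp : (f ∘ p) ∘ comma_map P = 0 by rewrite -compA pf comp0r.
have [|g eg] := prP _ _ (czero_hom OC (Z := comma_zero G OC E') e) (to_czero OC fp).
  apply/(comma_epiP abC abD rG); split=> //.
  by apply/epi0P => T t _; exact: (zero_hom_l zOC).
exists (htgt g ∘ i); move: (congr1 (fun x => htgt x ∘ i) eg).
by rewrite htgtM htgt_to_czero htgt_czero -!compA pi comp1r.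
Qed.

Lemma comma_left_syzygy (Z K P : comma G) (k : hom K P) (p : hom P Z) :
  projective P -> ses k p -> L Z -> L K.
Proof.
move=> prP skp /comma_left_elim[UZ [VZ [jZ [rZ [sZ [VVZ [rf sj rj sf fr]]]]]]].
have /comma_left_elim[_ [VP [jP [rP [sP [_ [rfP sjP rjP sfP frP]]]]]]] : L P.
  by move=> W _; exact: (ext1_proj (comma_abelian abC abD rG)).
have /(comma_sesP abC abD rG)[s1 s2] := skp.
have UK : U (comma_src K) by exact: (cot_syzygy UX (projective_src prP) s1 UZ).
have [kG eG] := amap_ses UZ s1.
(* [v] is the map induced by [p] between the cokernels of the structure maps. Its kernel [N] is a
   syzygy in [D]; the rest shows that 0 -> G(src K) -> tgt K -> N -> 0 is exact. *)
pose v := sZ ∘ htgt p ∘ jP.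
have vs : v ∘ sP = sZ ∘ htgt p.
  rewrite /v -[RHS]comp1r -frP compDr !compA.
  rewrite -[_ ∘ htgt p ∘ comma_map P]compA -comma_homP compA sf !comp0l add0r //.
have ev : epi v.
  apply: (@epi_comp_l _ _ _ _ _ sP); rewrite vs; apply: epi_comp; last by case: s2.
  exact: retraction_epi sj.
have [N [j sN]] := epi_ses abD ev.
have VN : V N.
  exact: (cot_syzygy VY (projective_coker_map prP sfP sjP) sN VVZ).
have [n jn] : exists n, j ∘ n = sP ∘ htgt k.
  apply: (ker_lift (proj1 sN)).
  by rewrite compA vs -compA (proj1 (proj1 s2)) comp0r.
apply: (@comma_left_intro K N n) => //.
have mK : mono (htgt k ∘ comma_map K).
  rewrite -comma_homP; apply: mono_comp (ker_mono kG).
  exact: section_mono rfP.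
split.
  apply/kerP; split.
  - apply: (ker_mono (proj1 sN)).
    by rewrite compA jn -compA -comma_homP compA sfP comp0l comp0r.
  - exact: mono_comp_r mK.
  (* An element killed by [n] lies in [G(src P)] inside the target of [P]. Its image in [G(src Z)]
     vanishes because [comma_map Z] is mono, so it comes from [G(src K)]. *)
  move=> T t nt; have spt : sP ∘ (htgt k ∘ t) = 0 by rewrite compA -jn -compA nt comp0r.
  have e1 : comma_map P ∘ (rP ∘ (htgt k ∘ t)) = htgt k ∘ t.
    by rewrite -[RHS]comp1l -frP compDl -[jP ∘ sP ∘ _]compA spt comp0r addr0 !compA.
  have [|y ky] := ker_lift kG (t := rP ∘ (htgt k ∘ t)).
    apply: (section_mono rf).
    rewrite compA comma_homP -compA e1 compA (proj1 (proj1 s2)) comp0l comp0r //.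
  exists y; apply: (ker_mono (proj1 s2)).
  by rewrite compA -comma_homP -compA ky.
(* For [n] to be epi: an element of [N], seen in the target of [P], has its image under [p] in
   [G(src Z)]. Subtracting a local lift of this image to [G(src P)] lands in the target of [K]. *)
have vj : sZ ∘ (htgt p ∘ (jP ∘ j)) = 0 by rewrite !compA -/v; case: sN => -[].
have [s fs] : exists s, comma_map Z ∘ s = htgt p ∘ (jP ∘ j).
  exists (rZ ∘ (htgt p ∘ (jP ∘ j))); rewrite -[RHS]comp1l -fr compDl.
  by rewrite -[jZ ∘ sZ ∘ _]compA vj comp0r addr0 compA.
have [T [e [s' [ee es]]]] := epi_lift abD s eG.
have [|y ky] := ker_lift (proj1 s2) (t := jP ∘ j ∘ e - comma_map P ∘ s').
  rewrite compBr !compA -comma_homP -(compA _ (amap _ _)) es compA fs.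
  by rewrite !compA subrr.
apply: (@epi_comp_l _ _ _ _ _ y); suff -> : n ∘ y = e by [].
apply: (ker_mono (proj1 sN)); rewrite compA jn -compA ky compBr !compA sjP sfP.
by rewrite comp0l comp1l subr0.
Qed.

(** The cover is (U0, G U0) + (0, V0), built from covers of both components. The target of its
    kernel is the pullback [H] of [f] and [q], an extension of [G U0] by [Y0], hence in [Y]. *)
Lemma comma_cover (W : comma G) : exists (R0 L0 : comma G) (f : hom R0 L0) (g : hom L0 W),
  [/\ L L0, XY R0 & ses f g].
Proof.
have [R0 [U0 [x [p [UU0 XR0 xp]]]]] := cot_cover UX (comma_src W).
have [Y0 [V0 [y [q [VV0 YY0 yq]]]]] := cot_cover VY (comma_tgt W).
have [B [i1 [i2 [p1 [p2 [p11 p22 p12 p21 ip]]]]]] := sum_ob abD (G U0) V0.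
have [f fE] : exists f, f = comma_map W ∘ amap G p by exists (comma_map W ∘ amap G p).
pose d := f ∘ p1 + q ∘ p2.
have [H [h1 [h2 [y' [qh h1y sH uH lH]]]]] := pullback_ses abD f yq.
pose ka := i1 ∘ h2 - i2 ∘ h1.
have p1ka : p1 ∘ ka = h2 by rewrite compBr !compA p11 p12 comp0l comp1l subr0.
have p2ka : p2 ∘ ka = - h1 by rewrite compBr !compA p22 p21 comp0l comp1l sub0r.
have di1 : d ∘ i1 = f by rewrite compDl -!compA p11 p21 comp0r comp1r addr0.
have di2 : d ∘ i2 = q by rewrite compDl -!compA p12 p22 !comp0r comp1r add0r.
have ska : ses ka d.
  split; last by apply: (@epi_comp_l _ _ _ _ _ i2); rewrite di2; case: yq.
  apply/kerP; split.
  - by rewrite compBr !compA di1 di2 qh subrr.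
  - apply/mono0P => T t kt; apply: uH; rewrite comp0r.
      by apply: oppr_inj; rewrite -compNl -p2ka -compA kt comp0r oppr0.
    by rewrite -p1ka -compA kt comp0r.
  move=> T t; rewrite compDl -!compA => dt.
  have [|s [s1 s2]] := lH T (- (p2 ∘ t)) (p1 ∘ t).
    by rewrite compNr; apply/eqP; rewrite eq_sym -addr_eq0 dt.
  exists s; rewrite compBl -!compA s1 s2 compNr opprK !compA -compDl ip comp1l //.
have [|eta [h1e h2e]] := lH (G R0) 0 (amap G x).
  by rewrite comp0r fE -compA -amapM (proj1 (proj1 xp)) amap0 comp0r.
pose K : comma G := CommaOb eta; pose M : comma G := CommaOb i1.
have hk : comma_map M ∘ amap G x = ka ∘ comma_map K.
  by rewrite compBl -!compA h1e h2e comp0r subr0.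
have hd : comma_map W ∘ amap G p = d ∘ comma_map M by rewrite di1 fE.
exists K, M, (@comma_mk _ _ _ K M _ _ hk), (@comma_mk _ _ _ M W _ _ hd); split.
- apply: (@comma_left_intro M V0 p2) => //; exact: ses_split_sum p21 p22 ip p11.
- split=> //; apply: (right_ext abD projD VY sH) => //; exact: G_U.
by apply/(comma_sesP abC abD rG).
Qed.

(** Write B for the target of [W]. The pushout [F] contains B with quotient [G U1], as [amap_ses]
    makes [amap G a] mono with cokernel [G U1]. Embedding [F] in [Y1] gives Q = Y1/B, which has F/B
    = G U1 as a subobject with quotient Y1/F = V1; so the cokernel (U1, Q) is in the left class. *)
Lemma comma_envelope (W : comma G) : exists (R1 L1 : comma G) (f : hom W R1) (g : hom R1 L1),
  [/\ L L1, XY R1 & ses f g].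
Proof.
have [X1 [U1 [a [u [UU1 XX1 au]]]]] := cot_envelope UX (comma_src W).
have Gau := amap_ses UU1 au.
have [B [i1 [i2 [p1 [p2 [p11 p22 p12 p21 ip]]]]]] := sum_ob abD (G X1) (comma_tgt W).
pose phi := i1 ∘ amap G a - i2 ∘ comma_map W.
have p1phi : p1 ∘ phi = amap G a by rewrite compBr !compA p11 p12 comp0l comp1l subr0.
have mphi : mono phi.
  by apply: (@mono_comp_r _ _ _ _ p1); rewrite p1phi; exact: ker_mono (proj1 Gau).
have [F [c sphi]] := mono_ses abD mphi.
have c12 : c ∘ i1 ∘ amap G a = c ∘ i2 ∘ comma_map W.
  by apply/eqP; rewrite -subr_eq0 -!compA -compBr (proj1 (proj1 sphi)).
have mb : mono (c ∘ i2).
  apply/mono0P => T t; rewrite -compA => /(ker_lift (proj1 sphi))[s ps].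
  have s0 : s = 0.
    apply: (proj1 (mono0P _) (ker_mono (proj1 Gau))).
    by rewrite -p1phi -compA ps compA p12 comp0l.
  by rewrite -[t]comp1l -p22 -compA -ps s0 !comp0r.
have [Y1 [V1 [y [v [VV1 YY1 yv]]]]] := cot_envelope VY F.
have my := ker_mono (proj1 yv).
pose g := y ∘ c ∘ i1; pose b := y ∘ c ∘ i2.
have mb' : mono b by rewrite /b -compA; exact: mono_comp.
have [Q [pi sb]] := mono_ses abD mb'.
have gb : g ∘ amap G a = b ∘ comma_map W.
  by rewrite /g /b -!compA; congr (y ∘ _); rewrite !compA.
have [|la lau] := coker_desc (ses_coker abD Gau) (t := pi ∘ g).
  by rewrite -compA gb compA (proj1 (proj1 sb)) comp0l.
have [|v' v'pi] := coker_desc (ses_coker abD sb) (t := v).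
  by rewrite /b !compA (proj1 (proj1 yv)) !comp0l.
pose R : comma G := CommaOb g; pose M : comma G := CommaOb la.
exists R, M, (@comma_mk _ _ _ W R _ _ gb), (@comma_mk _ _ _ R M _ _ lau); split=> //; last first.
  exact/(comma_sesP abC abD rG).
apply: (@comma_left_intro M V1 v') => //; split; last first.
  by apply: (@epi_comp_l _ _ _ _ _ pi); rewrite v'pi; case: yv.
apply: (kernel_of_local abD).
(* A lift [x] of [t] to [G X1] lands in B inside [Y1], so it comes from [G A] by the pushout and
   dies in [G U1]. *)
- apply/mono0P => T t lt.
  have [T' [e [x [ee ex]]]] := epi_lift abD t (proj2 Gau).
  apply: (proj1 (epi0P _) ee); rewrite -ex.
  have [|z bz] := ker_lift (proj1 sb) (t := g ∘ x).
    by rewrite compA -lau -compA ex compA lt comp0l.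
  have [|w pw] := ker_lift (proj1 sphi) (t := i1 ∘ x - i2 ∘ z).
    apply: my; rewrite comp0r compBr compA compBr !compA.
    by move: bz; rewrite /b /g => ->; rewrite subrr.
  have -> : x = amap G a ∘ w.
    by rewrite -p1phi -compA pw compBr !compA p11 p12 comp0l comp1l subr0.
  by rewrite compA (proj1 (proj1 Gau)) comp0l.
- apply: (proj1 (epi0P _) (proj2 Gau)); rewrite -compA lau compA v'pi.
  by rewrite /g !compA (proj1 (proj1 yv)) !comp0l.
move=> T t vt; have [T1 [e1 [t1 [ee1 et1]]]] := epi_lift abD t (proj2 sb).
have [|s ys] := ker_lift (proj1 yv) (t := t1).
  by rewrite -v'pi -compA et1 compA vt comp0l.
have [T2 [e2 [s' [ee2 es]]]] := epi_lift abD s (proj2 sphi).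
exists T2, (e1 ∘ e2), (amap G u ∘ (p1 ∘ s')); split; first exact: epi_comp.
change (la ∘ (amap G u ∘ (p1 ∘ s')) = t ∘ (e1 ∘ e2)).
have z : pi ∘ (y ∘ (c ∘ (i2 ∘ (p2 ∘ s')))) = 0.
  by rewrite !compA -(compA pi) -(compA pi) (proj1 (proj1 sb)) !comp0l.
rewrite compA lau (compA t) -et1 -ys -!compA -es.
by rewrite -[in RHS](comp1l s') -ip compDl !compDr -!compA z addr0.
Qed.

Lemma comma_cotorsion : cotorsion L XY.
Proof.
split; [by []| |exact: comma_cover|exact: comma_envelope| ].
- move=> W; split=> [XYW Z LZ|h]; first exact: LZ.
  (* By [amap_ses] a sequence in [C] ending in [U] remains exact under [comma_diag G], so
     orthogonality to (A, G A) restricts to sources; (0, B) tests the targets. *)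
  split; [apply/(cot_right UX) => A UA K E k p kp f|].
    have skp : ses (diag_hom (Z := comma_diag G E) k) (diag_hom (Z := comma_diag G A) p).
      apply/(comma_sesP abC abD rG); split=> //; rewrite !htgt_mk /= !comp1l.
      exact: amap_ses kp.
    have [g gk] := h _ (left_diag UA) _ _ _ _ skp (diag_hom f).
    by exists (hsrc g); exact: (hsrc_eq gk).
  apply/(cot_right VY) => B VB; apply/(ext1_czeroP zOC); apply: h.
  exact: left_czero.
move=> Z K P k p prP kp; exact: (comma_left_syzygy prP kp).
Qed.

End CommaCotorsion.

(** * Equivalences, quotients and localizations *)

Section Equivalences.

Definition inverse_of (A : category) (X Y : A) (f : chom X Y) (g : chom Y X) : Prop :=
  ccomp g f = cid X /\ ccomp f g = cid Y.

Lemma ccompE (A : category) (X Y Z T : A) (g : chom Y Z) (f : chom X Y)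
    (u : chom X Z) (h : chom Z T) :
  ccomp g f = u -> ccomp (ccomp h g) f = ccomp h u.
Proof. by move=> <-; rewrite ccompA. Qed.

Lemma equivalent_sym (A B : category) :
  equivalent_categories A B -> equivalent_categories B A.
Proof. by move=> [F [G [h1 h2]]]; exists G, F. Qed.

Lemma natural_iso_comp (A B C : category) (F1 : functor A B) (G1 : functor B A)
    (F2 : functor B C) (G2 : functor C B) :
  natural_iso (functor_comp G1 F1) (functor_id A) ->
  natural_iso (functor_comp G2 F2) (functor_id B) ->
  natural_iso (functor_comp (functor_comp G1 G2) (functor_comp F2 F1)) (functor_id A).
Proof.
move=> [t1 [s1 [n1 [st1 ts1]]]] [t2 [s2 [n2 [st2 ts2]]]].
exists (fun X => ccomp (t1 X) (fmap G1 (t2 (F1 X)))).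
exists (fun X => ccomp (fmap G1 (s2 (F1 X))) (s1 X)).
split; [|split].
- move=> X Y f; rewrite /= ccompA; have /= -> := n1 _ _ f.
  rewrite -!ccompA; congr ccomp.
  by have := congr1 (@fmap _ _ G1 _ _) (n2 _ _ (fmap F1 f)); rewrite !fmapM.
- move=> X /=; rewrite ccompA (ccompE _ (st1 X)) ccomp1r -fmapM.
  by rewrite st2 fmap1.
- move=> X /=; have e := congr1 (@fmap _ _ G1 _ _) (ts2 (F1 X)).
  rewrite fmapM fmap1 /= in e.
  rewrite ccompA (ccompE _ e) ccomp1r; exact: ts1.
Qed.

Lemma equivalent_trans (A B C : category) :
  equivalent_categories A B -> equivalent_categories B C -> equivalent_categories A C.
Proof.
move=> [F1 [G1 [a1 b1]]] [F2 [G2 [a2 b2]]].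
exists (functor_comp F2 F1), (functor_comp G1 G2).
by split; exact: natural_iso_comp.
Qed.

Definition functor_prod (A A' B B' : category) (F : functor A B) (F' : functor A' B') :
    functor (prod_category A A') (prod_category B B').
Proof.
refine (@Functor (prod_category A A') (prod_category B B')
  (fun X => (F X.1, F' X.2)) (fun X Y f => (fmap F f.1, fmap F' f.2)) _ _).
- by move=> X /=; rewrite !fmap1.
- by move=> X Y Z g f /=; rewrite !fmapM.
Defined.

Lemma equivalent_prod (A A' B B' : category) :
  equivalent_categories A B -> equivalent_categories A' B' ->
  equivalent_categories (prod_category A A') (prod_category B B').
Proof.
move=> [F [G [[t1 [s1 [n1 [st1 ts1]]]] [t2 [s2 [n2 [st2 ts2]]]]]]].
move=> [F' [G' [[t1' [s1' [n1' [st1' ts1']]]] [t2' [s2' [n2' [st2' ts2']]]]]]].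
exists (functor_prod F F'), (functor_prod G G'); split.
  exists (fun X => (t1 X.1, t1' X.2)), (fun X => (s1 X.1, s1' X.2)); split; [|split].
  - by move=> X Y f /=; congr pair; [exact: n1|exact: n1'].
  - by move=> X /=; rewrite st1 st1'.
  - by move=> X /=; rewrite ts1 ts1'.
exists (fun X => (t2 X.1, t2' X.2)), (fun X => (s2 X.1, s2' X.2)); split; [|split].
- by move=> X Y f /=; congr pair; [exact: n2|exact: n2'].
- by move=> X /=; rewrite st2 st2'.
- by move=> X /=; rewrite ts2 ts2'.
Qed.

Lemma equivalent_of_functor (A B : category) (F : functor A B) :
  (forall X Y (g : chom (F X) (F Y)), exists f : chom X Y, fmap F f = g) ->
  (forall X Y (f f' : chom X Y), fmap F f = fmap F f' -> f = f') ->
  (forall Z, exists X (t : chom (F X) Z) s, inverse_of t s) ->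
  equivalent_categories A B.
Proof.
move=> full faith es.
have ch Z : {X : A & {t : chom (F X) Z & {s | inverse_of t s}}}.
  have [X /boolp.cid[t /boolp.cid[s ts]]] := boolp.cid (es Z).
  by exists X, t, s.
pose o Z := projT1 (ch Z); pose t Z : chom (F (o Z)) Z := projT1 (projT2 (ch Z)).
pose s Z : chom Z (F (o Z)) := sval (projT2 (projT2 (ch Z))).
have ts Z : inverse_of (t Z) (s Z) := svalP (projT2 (projT2 (ch Z))).
have lift Z Z' (g : chom Z Z') : {f : chom (o Z) (o Z') | fmap F f = ccomp (s Z') (ccomp g (t Z))}.
  exact/boolp.cid/full.
have Gid Z : sval (lift Z Z (cid Z)) = cid (o Z).
  by apply: faith; rewrite (svalP (lift _ _ _)) ccomp1l fmap1; case: (ts Z).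
have GM Z1 Z2 Z3 (g : chom Z2 Z3) (f : chom Z1 Z2) :
    sval (lift _ _ (ccomp g f)) = ccomp (sval (lift _ _ g)) (sval (lift _ _ f)).
  apply: faith; rewrite fmapM !(svalP (lift _ _ _)) !ccompA.
  by rewrite (ccompE _ (proj2 (ts Z2))) ccomp1r.
pose G := @Functor B A o (fun Z Z' g => sval (lift Z Z' g)) Gid GM.
exists F, G; split; last first.
  exists t, s; split; [|split=> Z; [exact: (proj1 (ts Z))|exact: (proj2 (ts Z))]].
  move=> Z Z' g /=; rewrite (svalP (lift _ _ _)) !ccompA (proj2 (ts Z')).
  by rewrite ccomp1l.
have u X : {u : chom (o (F X)) X | fmap F u = t (F X)} by exact/boolp.cid/full.
have v X : {v : chom X (o (F X)) | fmap F v = s (F X)} by exact/boolp.cid/full.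
exists (fun X => sval (u X)), (fun X => sval (v X)); split; [|split].
- move=> X Y f /=; apply: faith; rewrite !fmapM (svalP (lift _ _ _)) !(svalP (u _)).
  by rewrite !ccompA (proj2 (ts (F Y))) ccomp1l.
- by move=> X /=; apply: faith; rewrite fmapM (svalP (u X)) (svalP (v X)) fmap1 (proj1 (ts (F X))).
- by move=> X /=; apply: faith; rewrite fmapM (svalP (u X)) (svalP (v X)) fmap1 (proj2 (ts (F X))).
Qed.

End Equivalences.

(** * Quotient of a category by a congruence *)

Section Quotient.

Record congruence (A : category) := Congruence {
  crel : forall X Y : A, chom X Y -> chom X Y -> Prop;
  crel_refl : forall X Y (f : chom X Y), crel f f;
  crel_sym : forall X Y (f g : chom X Y), crel f g -> crel g f;
  crel_trans : forall X Y (f g h : chom X Y), crel f g -> crel g h -> crel f h;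
  crel_comp : forall X Y Z (g g' : chom Y Z) (f f' : chom X Y),
    crel g g' -> crel f f' -> crel (ccomp g f) (ccomp g' f') }.

Variables (A : category) (r : congruence A).

(** Equivalence classes as predicates: extensionality turns related representatives into equal
    morphisms. *)
Definition qhom (X Y : A) : Type :=
  {P : chom X Y -> Prop | exists f, P = crel r f}.

Definition qpi (X Y : A) (f : chom X Y) : qhom X Y :=
  exist _ (crel r f) (ex_intro _ f erefl).

Definition qrep (X Y : A) (u : qhom X Y) : chom X Y := sval (boolp.cid (svalP u)).

Lemma qpiP (X Y : A) (f g : chom X Y) : qpi f = qpi g <-> crel r f g.
Proof.
split=> [/(congr1 sval) /= e|fg]; first by rewrite e; exact: crel_refl.
apply: eq_exist => /=; apply/funext => h; apply/propext; split=> [fh|gh].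
  exact: crel_trans (crel_sym fg) fh.
exact: crel_trans fg gh.
Qed.

Lemma qrepK (X Y : A) (u : qhom X Y) : qpi (qrep u) = u.
Proof.
case: u => P hP; apply: eq_exist => /=; rewrite /qrep; case: boolp.cid => f /= ->.
by [].
Qed.

Definition qcomp (X Y Z : A) (u : qhom Y Z) (v : qhom X Y) : qhom X Z :=
  qpi (ccomp (qrep u) (qrep v)).

Lemma qcompE (X Y Z : A) (g : chom Y Z) (f : chom X Y) :
  qcomp (qpi g) (qpi f) = qpi (ccomp g f).
Proof. by apply/qpiP; apply: crel_comp; apply/qpiP; exact: qrepK. Qed.

Definition quotient_category : category.
Proof.
refine (@Category A qhom (fun X => qpi (cid X)) qcomp _ _ _).
- move=> W X Y Z h g f; rewrite -[h]qrepK -[g]qrepK -[f]qrepK !qcompE.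
  by rewrite ccompA.
- by move=> X Y f; rewrite -[f]qrepK qcompE ccomp1l.
- by move=> X Y f; rewrite -[f]qrepK qcompE ccomp1r.
Defined.

Section Lift.
Variables (B : category) (F : functor A B).
Hypothesis Fr : forall X Y (f g : chom X Y), crel r f g -> fmap F f = fmap F g.

Definition quotient_map (X Y : A) (u : qhom X Y) : chom (F X) (F Y) := fmap F (qrep u).

Lemma quotient_mapE (X Y : A) (f : chom X Y) : quotient_map (qpi f) = fmap F f.
Proof. by apply: Fr; apply/qpiP; exact: qrepK. Qed.

Definition quotient_lift : functor quotient_category B.
Proof.
refine (@Functor quotient_category B F quotient_map _ _).
- by move=> X; rewrite quotient_mapE fmap1.
- move=> X Y Z g f; rewrite -[g]qrepK -[f]qrepK [ccomp _ _]qcompE.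
  by rewrite !quotient_mapE fmapM.
Defined.

Lemma quotient_liftE (X Y : A) (f : chom X Y) : fmap quotient_lift (qpi f) = fmap F f.
Proof. exact: quotient_mapE. Qed.

End Lift.
End Quotient.

Definition full_subcategory (A : category) (P : A -> Prop) : category :=
  @Category {X : A | P X} (fun X Y => chom (sval X) (sval Y)) (fun X => cid (sval X))
    (fun X Y Z g f => ccomp g f) (fun W X Y Z h g f => ccompA h g f)
    (fun X Y f => ccomp1l f) (fun X Y f => ccomp1r f).

(** * Universal property of the localization *)

Section LocalizationTheory.
Variables (A : category) (W : forall X Y : A, chom X Y -> Prop).

Definition loc_map (X Y : A) (f : chom X Y) : @chom (localization W) X Y :=
  loc_pi (loc_of W f).

Lemma loc_mapM (X Y Z : A) (g : chom Y Z) (f : chom X Y) :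
  loc_map (ccomp g f) = ccomp (loc_map g) (loc_map f).
Proof. rewrite /loc_map [RHS]loc_hcompE; exact/loc_piP/loc_ofM. Qed.

Definition loc_map_inv (X Y : A) (w : chom X Y) (hw : W w) :
  @chom (localization W) Y X := loc_pi (loc_inv hw).

Lemma loc_map_invP (X Y : A) (w : chom X Y) (hw : W w) :
  inverse_of (loc_map w) (loc_map_inv hw).
Proof.
by split; rewrite [LHS]loc_hcompE; apply/loc_piP; [exact: loc_invK|exact: loc_invVK].
Qed.

(** By induction on terms: the square for a formal inverse is the square for [w] conjugated by
    invertible maps. *)
Lemma loc_natural (B : category) (H K : functor (localization W) B)
    (t : forall X : A, chom (H X) (K X)) :
  (forall X Y (f : chom X Y),
     ccomp (fmap K (loc_map f)) (t X) = ccomp (t Y) (fmap H (loc_map f))) ->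
  forall (X Y : localization W) (u : chom X Y),
    ccomp (fmap K u) (t X) = ccomp (t Y) (fmap H u).
Proof.
move=> nat X Y u; have [v {u}->] := loc_piE u; elim: X Y / v.
- by move=> X Y f; exact: nat.
- move=> X Y w hw; rewrite -/(loc_map_inv hw).
  have [e1 e2] := loc_map_invP hw.
  rewrite -[LHS]ccomp1r -fmap1 -e2 fmapM !ccompA (ccompE _ (esym (nat _ _ w))).
  by rewrite ccompA -fmapM e1 fmap1 ccomp1l.
move=> X Y Z v IHv v' IHv'; have -> : loc_pi (loc_comp v v') =
    @ccomp (localization W) _ _ _ (loc_pi v) (loc_pi v') by rewrite [RHS]loc_hcompE.
by rewrite !fmapM -ccompA IHv' !ccompA IHv.
Qed.

Section Lift.
Variables (B : category) (F : functor A B).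
Hypothesis Finv : forall (X Y : A) (w : chom X Y), W w ->
  exists g, inverse_of (fmap F w) g.

Fixpoint loc_eval (X Y : A) (t : loc_term W X Y) : chom (F X) (F Y) :=
  match t in loc_term _ X Y return chom (F X) (F Y) with
  | loc_of _ _ f => fmap F f
  | loc_inv _ _ w hw => sval (boolp.cid (Finv hw))
  | loc_comp _ _ _ t s => ccomp (loc_eval t) (loc_eval s)
  end.

Lemma loc_eval_eq (X Y : A) (t s : loc_term W X Y) : loc_eq t s -> loc_eval t = loc_eval s.
Proof.
elim=> {X Y t s} //=.
- by move=> X Y t s r _ -> _ ->.
- by move=> X Y Z t t' s s' _ -> _ ->.
- by move=> *; rewrite ccompA.
- by move=> *; rewrite fmap1 ccomp1l.
- by move=> *; rewrite fmap1 ccomp1r.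
- by move=> *; rewrite fmapM.
- by move=> X Y w hw; case: boolp.cid => g [/= e _]; rewrite e fmap1.
- by move=> X Y w hw; case: boolp.cid => g [/= _ e]; rewrite e fmap1.
Qed.

Definition loc_lift_map (X Y : A) (u : loc_hom W X Y) : chom (F X) (F Y) :=
  loc_eval (sval (boolp.cid (loc_piE u))).

Lemma loc_lift_mapE (X Y : A) (t : loc_term W X Y) : loc_lift_map (loc_pi t) = loc_eval t.
Proof.
by apply: loc_eval_eq; apply/loc_piP; case: boolp.cid.
Qed.

Definition loc_lift : functor (localization W) B.
Proof.
refine (@Functor (localization W) B F loc_lift_map _ _).
- by move=> X; rewrite [LHS]loc_lift_mapE /= fmap1.
- move=> X Y Z g f; have [t ->] := loc_piE g; have [s ->] := loc_piE f.
  by rewrite [ccomp _ _]loc_hcompE !loc_lift_mapE.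
Defined.

Lemma loc_liftE (X Y : A) (f : chom X Y) : fmap loc_lift (loc_map f) = fmap F f.
Proof. exact: loc_lift_mapE. Qed.

End Lift.
End LocalizationTheory.

(** * The localization as an additive quotient *)

Section Stable.
Variables (A : preadditive) (abA : abelian A).
Variables (L R : A -> Prop) (cot : cotorsion L R).
Implicit Types X Y Z T : A.

Let omega := inter_class L R.

Lemma omega_zero O : is_zero O -> omega O.
Proof. by move=> zO; split; [exact: (left_zero abA cot)|exact: (right_zero cot)]. Qed.

Lemma omega_sum X1 X2 X : is_direct_sum X1 X2 X -> omega X1 -> omega X2 -> omega X.
Proof.
move=> s [L1 R1] [L2 R2]; split; first exact/(left_sum abA cot s).
exact/(right_sum cot s).
Qed.

Definition factors X Y (f : hom X Y) : Prop :=
  exists (W : A) (s : hom X W) (t : hom W Y), omega W /\ f = t ∘ s.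

Lemma factors0 X Y : factors (0 : hom X Y).
Proof.
have [O zO] := zero_ob abA; exists O, 0, 0; split; first exact: omega_zero.
by rewrite comp0r.
Qed.

Lemma factorsN X Y (f : hom X Y) : factors f -> factors (- f).
Proof. by move=> [W [s [t [oW ->]]]]; exists W, s, (- t); rewrite compNl. Qed.

Lemma factorsD X Y (f g : hom X Y) : factors f -> factors g -> factors (f + g).
Proof.
move=> [W1 [s1 [t1 [o1 ->]]]] [W2 [s2 [t2 [o2 ->]]]].
have [W sW] := sum_ob abA W1 W2; exists W.
have oW := omega_sum sW o1 o2; have [i1 [i2 [p1 [p2 [p11 p22 p12 p21 ip]]]]] := sW.
exists (i1 ∘ s1 + i2 ∘ s2), (t1 ∘ p1 + t2 ∘ p2); split=> //.
rewrite compDl !compDr !compA !(compE _ p11) !(compE _ p12) !(compE _ p21) !(compE _ p22).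
by rewrite !comp0r !comp0l !comp1r addr0 add0r.
Qed.

Lemma factors_compl X Y Z (g : hom Y Z) (f : hom X Y) : factors f -> factors (g ∘ f).
Proof. by move=> [W [s [t [oW ->]]]]; exists W, s, (g ∘ t); rewrite compA. Qed.

Lemma factors_compr X Y Z (g : hom Y Z) (f : hom X Y) : factors g -> factors (g ∘ f).
Proof. by move=> [W [s [t [oW ->]]]]; exists W, (s ∘ f), t; rewrite compA. Qed.

(** In the envelope 0 -> X -> R1 -> L1 -> 0 the object [R1] is an extension of [L1] by [X], hence in
    the core, and [f] extends to it because [L1] is orthogonal to [Y]. *)
Lemma factors_left_right X Y (f : hom X Y) : L X -> R Y -> factors f.
Proof.
move=> LX RY; have [R1 [L1 [i [p [LL1 RR1 ip]]]]] := cot_envelope cot X.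
have [g gi] := cot_ext1 cot LL1 RY ip f; exists R1, i, g; split=> //.
by split=> //; exact: (left_ext abA cot ip).
Qed.

(** The second half [t] of the factorization lifts to [E], as the core is orthogonal to [K]. The
    difference between [h] and the lifted composite maps [X] to [K], and such maps factor by
    [factors_left_right]. So [q] can be cancelled modulo the core. *)
Lemma factors_lift K E B X (k : hom K E) (q : hom E B) (h : hom X E) :
  L X -> R K -> ses k q -> factors (q ∘ h) -> factors h.
Proof.
move=> LX RK kq [W [s [t [oW e]]]].
have [l ql] := ext1_lift abA (cot_ext1 cot (proj1 oW) RK) kq t.
have [|d kd] := ker_lift (proj1 kq) (t := h - l ∘ s).
  by rewrite compBr compA ql e subrr.
rewrite -[h](subrK (l ∘ s)) -kd; apply: factorsD.
  by apply: factors_compl; exact: factors_left_right.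
by exists W, s, l.
Qed.

Definition stable_rel (X Y : full_subcategory (A := cat_of A) L) (f g : chom X Y) : Prop :=
  @factors (sval X) (sval Y) ((f : hom (sval X) (sval Y)) - g).

Definition stable_congruence : congruence (full_subcategory (A := cat_of A) L).
Proof.
refine (@Congruence _ stable_rel _ _ _ _); rewrite /stable_rel.
- by move=> X Y f; rewrite subrr; exact: factors0.
- by move=> X Y f g fg; rewrite -opprB; exact: factorsN.
- by move=> X Y f g h fg gh; rewrite -(subrK g f) -addrA; exact: factorsD.
- move=> X Y Z g g' f f' gg ff /=.
  rewrite -(subrK (g ∘ f') (g ∘ f)) -addrA -compBr -compBl; apply: factorsD.
    exact: factors_compl.
  exact: factors_compr.
Defined.

Definition stable_category : category := quotient_category stable_congruence.

Definition stable_map (X Y : full_subcategory (A := cat_of A) L) (f : hom (sval X) (sval Y)) :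
  @chom stable_category X Y := qpi stable_congruence f.

Lemma stable_mapP (X Y : full_subcategory (A := cat_of A) L) (f g : hom (sval X) (sval Y)) :
  stable_map f = stable_map g <-> factors (f - g).
Proof. exact: qpiP. Qed.

Lemma stable_mapM (X Y Z : full_subcategory (A := cat_of A) L)
    (g : hom (sval Y) (sval Z)) (f : hom (sval X) (sval Y)) :
  ccomp (stable_map g) (stable_map f) = stable_map (g ∘ f).
Proof. exact: qcompE. Qed.

Lemma stable_map1 (X : full_subcategory (A := cat_of A) L) :
  stable_map (idm (sval X)) = cid (X : stable_category).
Proof. by []. Qed.

Lemma stable_mapE (X Y : stable_category) (u : chom X Y) :
  exists f, u = stable_map f.
Proof. by exists (qrep u); rewrite /stable_map qrepK. Qed.

Record cover (X : A) := Cover {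
  cov_ker : A;
  cov_ob : A;
  cov_incl : hom cov_ker cov_ob;
  cov_map : hom cov_ob X;
  cov_left : L cov_ob;
  cov_right : R cov_ker;
  cov_ses : ses cov_incl cov_map }.

Lemma cover_ex X : inhabited (cover X).
Proof.
have [R0 [L0 [f [g [? ? s]]]]] := cot_cover cot X.
exact: (inhabits (@Cover X R0 L0 f g _ _ s)).
Qed.

Definition chosen_cover X : cover X :=
  let: exist c _ := boolp.cid (P := fun _ : cover X => True)
    (let: inhabits c := cover_ex X in ex_intro _ c I) in c.

Definition cofib X : stable_category := exist _ _ (cov_left (chosen_cover X)).

Definition cofib_proj X : hom (sval (cofib X)) X := cov_map (chosen_cover X).

Lemma cofib_lift X (M : A) (f : hom M X) : L M ->
  exists g : hom M (sval (cofib X)), cofib_proj X ∘ g = f.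
Proof.
move=> LM; apply: (ext1_lift abA _ (cov_ses (chosen_cover X))).
exact: (cot_ext1 cot LM (cov_right _)).
Qed.

Lemma cofib_factors X M (h : hom M (sval (cofib X))) : L M ->
  factors (cofib_proj X ∘ h) -> factors h.
Proof. by move=> LM; apply: (factors_lift LM (cov_right _) (cov_ses _)). Qed.

Definition cofib_map X Y (f : hom X Y) : @chom stable_category (cofib X) (cofib Y) :=
  stable_map (sval (boolp.cid (cofib_lift (f ∘ cofib_proj X) (cov_left _)))).

(** Cancelling [cofib_proj Y] modulo the core frees [cofib_map] from the chosen lift; functoriality
    and additivity modulo the core rest on this. *)
Lemma cofib_mapE X Y (f : hom X Y) (a : hom (sval (cofib X)) (sval (cofib Y))) :
  factors (cofib_proj Y ∘ a - f ∘ cofib_proj X) -> cofib_map f = stable_map a.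
Proof.
move=> h; rewrite /cofib_map; case: boolp.cid => b /= e.
apply/stable_mapP; apply: cofib_factors; first exact: cov_left.
by rewrite compBr e -opprB; exact: factorsN.
Qed.

Lemma cofib_mapP X Y (f : hom X Y) : exists a : hom (sval (cofib X)) (sval (cofib Y)),
  cofib_proj Y ∘ a = f ∘ cofib_proj X /\ cofib_map f = stable_map a.
Proof.
have [a e] := cofib_lift (f ∘ cofib_proj X) (cov_left _).
by exists a; split=> //; apply: cofib_mapE; rewrite e subrr; exact: factors0.
Qed.

Lemma cofib_map_eq X Y (f g : hom X Y) : factors (f - g) -> cofib_map f = cofib_map g.
Proof.
move=> fg; have [a [e ->]] := cofib_mapP g; apply: cofib_mapE.
by rewrite e -compBl; apply: factors_compr; rewrite -opprB; exact: factorsN.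
Qed.

Lemma cofib_map1 X : cofib_map (idm X) = cid (cofib X).
Proof.
rewrite -stable_map1; apply: cofib_mapE.
by rewrite comp1l comp1r subrr; exact: factors0.
Qed.

Lemma cofib_mapM X Y Z (g : hom Y Z) (f : hom X Y) :
  cofib_map (g ∘ f) = ccomp (cofib_map g) (cofib_map f).
Proof.
have [a [ea ->]] := cofib_mapP f; have [b [eb ->]] := cofib_mapP g.
rewrite stable_mapM; apply: cofib_mapE.
by rewrite compA eb -!compA ea subrr; exact: factors0.
Qed.

Definition cofib_functor : functor (cat_of A) stable_category :=
  @Functor (cat_of A) stable_category cofib cofib_map cofib_map1 cofib_mapM.

Notation weq := (@Weq A (model_of_pair L R)).

(** The inverse is [cofib_proj Y] lifted first through [p], whose kernel is in [R], and then through
    [cofib_proj X]. *)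
Lemma cofib_inverts_epi K X Y (k : hom K X) (p : hom X Y) : R K -> ses k p ->
  exists g, inverse_of (cofib_map p) g.
Proof.
move=> RK kp; have [a [ea ->]] := cofib_mapP p.
have LY := cov_left (chosen_cover Y).
have [l pl] := ext1_lift abA (cot_ext1 cot LY RK) kp (cofib_proj Y).
have [s sl] := cofib_lift l LY.
exists (@stable_map (cofib Y) (cofib X) s); split; rewrite stable_mapM -stable_map1; apply/stable_mapP.
  apply: cofib_factors; first exact: cov_left.
  apply: (factors_lift (cov_left _) RK kp).
  by rewrite !compBr !compA -(compA p) sl pl ea comp1r subrr; exact: factors0.
apply: cofib_factors => //.
by rewrite compBr compA ea -compA sl pl comp1r subrr; exact: factors0.
Qed.

Lemma cofib_inverts_mono X Y Q (i : hom X Y) (c : hom Y Q) :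
  split_mono i -> is_cokernel i c -> omega Q ->
  exists g, inverse_of (cofib_map i) g.
Proof.
move=> [r ri] ci oQ; exists (cofib_map r).
split; rewrite -cofib_mapM ?ri -cofib_map1 //; apply: cofib_map_eq.
(* [i ∘ r - idm Y] kills [i], so it factors through the cokernel [Q], which is in the core. *)
have [|t tc] := coker_desc ci (t := i ∘ r - idm Y).
  by rewrite compBl -compA ri comp1l comp1r subrr.
by exists Q, c, t.
Qed.

Lemma cofib_inverts_weq X Y (w : hom X Y) : weq w ->
  exists g, inverse_of (cofib_map w) g.
Proof.
move=> [Z [i [p [-> si [Q [c [ci oQ]]] ep [K [k [kp RK]]]]]]].
have [g [g1 g2]] := cofib_inverts_mono si ci oQ.
have [h [h1 h2]] := cofib_inverts_epi RK (conj kp ep).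
exists (ccomp g h); rewrite cofib_mapM; split.
  by rewrite !ccompA (ccompE _ h1) ccomp1r.
by rewrite !ccompA (ccompE _ g2) ccomp1r.
Qed.

Lemma weq_epi K X Y (k : hom K X) (p : hom X Y) : R K -> ses k p -> weq p.
Proof.
move=> RK [kp ep]; have [O zO] := zero_ob abA.
exists X, (idm X), p; split; [by rewrite comp1r|by exists (idm X); rewrite comp1l| |by []|by exists K, k].
by exists O, 0; split; [exact: (ses_coker abA (ses_id0 X zO))|exact: omega_zero].
Qed.

Lemma weq_split_mono X Y Q (i : hom X Y) (c : hom Y Q) :
  split_mono i -> is_cokernel i c -> omega Q -> weq i.
Proof.
move=> si ci oQ; have [O zO] := zero_ob abA.
exists Y, i, (idm Y); split; [by rewrite comp1l|by []|by exists Q, c|exact: epi_idm|].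
by exists O, 0; split; [case: (ses_0id Y zO)|case: (omega_zero zO)].
Qed.

Notation loc f := (loc_map (A := cat_of A) weq f).

(* The inclusion and the graph of [s] are both sections of the projection
   [X ⊕ W -> X], which is inverted. *)
Lemma loc_factors X Y (f g : hom X Y) : factors (f - g) -> loc f = loc g.
Proof.
move=> [W [s [t [oW e]]]].
have [B sB] := sum_ob abA X W; have [i1 [i2 [p1 [p2 [p11 p22 p12 p21 ip]]]]] := sB.
have wi : weq i1.
  apply: (@weq_split_mono _ _ W i1 p2) => //; first by exists p1.
  exact: (ses_coker abA (ses_split_sum p21 p22 ip p11)).
have [v1 v2] := loc_map_invP (A := cat_of A) wi.
have p1i : ccomp (loc p1) (loc i1) = cid (X : localization (A := cat_of A) weq) by rewrite -loc_mapM /= p11.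
have i1p : ccomp (loc i1) (loc p1) = cid (B : localization (A := cat_of A) weq).
  by rewrite -[ccomp _ _]ccomp1r -v2 ccompA (ccompE _ p1i) ccomp1r.
have e1 : p1 ∘ (i1 + i2 ∘ s) = idm X by rewrite compDr compA p11 p12 comp0l addr0.
have li : loc (i1 + i2 ∘ s) = loc i1.
  have p1l : ccomp (loc p1) (loc (i1 + i2 ∘ s)) = cid (X : localization (A := cat_of A) weq).
    by rewrite -loc_mapM /= e1.
  by rewrite -[LHS]ccomp1l -i1p -ccompA p1l ccomp1r.
pose d := g ∘ p1 + t ∘ p2.
have -> : f = d ∘ (i1 + i2 ∘ s).
  rewrite /d compDl !compDr !compA !(compE _ p11) !(compE _ p12) !(compE _ p21) !(compE _ p22).
  by rewrite !comp0r !comp0l !comp1r addr0 add0r -e addrC subrK.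
have -> : g = d ∘ i1.
  by rewrite /d compDl !(compE _ p11) !(compE _ p21) comp0r comp1r addr0.
by rewrite [LHS](@loc_mapM (cat_of A)) [RHS](@loc_mapM (cat_of A)) li.
Qed.

Definition left_to_loc :
    functor (full_subcategory (A := cat_of A) L) (localization (A := cat_of A) weq) :=
  @Functor (full_subcategory (A := cat_of A) L) (localization (A := cat_of A) weq)
    (fun M => sval M) (fun M N f => @loc_map (cat_of A) weq (sval M) (sval N) f)
    (fun M => erefl) (fun M N P g f => @loc_mapM (cat_of A) weq _ _ _ g f).

Definition stable_to_loc : functor stable_category (localization (A := cat_of A) weq) :=
  @quotient_lift _ stable_congruence _ left_to_loc (fun M N f g => @loc_factors _ _ f g).

Lemma stable_to_locE (X Y : full_subcategory (A := cat_of A) L) (f : hom (sval X) (sval Y)) :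
  fmap stable_to_loc (stable_map f) = loc f.
Proof. exact: (quotient_liftE _ (F := left_to_loc) f). Qed.

Definition loc_to_stable : functor (localization (A := cat_of A) weq) stable_category :=
  @loc_lift (cat_of A) weq stable_category cofib_functor cofib_inverts_weq.

Lemma loc_to_stableE X Y (f : hom X Y) : fmap loc_to_stable (loc f) = cofib_map f.
Proof. exact: loc_liftE. Qed.

(** Both comparison transformations are given by the cover maps: in the localization they are weak
    equivalences by [weq_epi], and in the quotient they have inverses because covers of objects of
    [L] split. *)
Lemma Ho_stable : equivalent_categories (Ho (model_of_pair L R)) stable_category.
Proof.
exists loc_to_stable, stable_to_loc; split.
  exists (fun X => loc (cofib_proj X)).
  exists (fun X => loc_map_inv (A := cat_of A) (weq_epi (cov_right _) (cov_ses (chosen_cover X)))).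
  split; [|by split=> X; have [] := loc_map_invP (A := cat_of A) (weq_epi (cov_right _) (cov_ses (chosen_cover X)))].
  apply: (@loc_natural (cat_of A) weq _ (functor_comp stable_to_loc loc_to_stable) (functor_id _)).
  move=> X Y f; have [a [ea fa]] := cofib_mapP f.
  change (ccomp (loc f) (loc (cofib_proj X)) =
    ccomp (loc (cofib_proj Y)) (fmap stable_to_loc (fmap loc_to_stable (loc f)))).
  by rewrite loc_to_stableE fa stable_to_locE -!loc_mapM /= ea.
have sec (M : stable_category) : {s : hom (sval M) (sval (cofib (sval M))) | cofib_proj (sval M) ∘ s = idm _}.
  by apply/boolp.cid/cofib_lift; case: M.
exists (fun M => @stable_map (cofib (sval M)) M (cofib_proj (sval M))).
exists (fun M => @stable_map M (cofib (sval M)) (sval (sec M))); split; [|split].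
- move=> M N u; have [f ->] := stable_mapE u; have [a [ea fa]] := cofib_mapP f.
  change (ccomp (stable_map f) (stable_map (cofib_proj (sval M))) =
    ccomp (stable_map (cofib_proj (sval N))) (fmap loc_to_stable (fmap stable_to_loc (stable_map f)))).
  by rewrite stable_to_locE loc_to_stableE fa !stable_mapM ea.
- move=> M; rewrite [LHS]stable_mapM; apply/(@stable_mapP (cofib _) (cofib _) _ (idm _)).
  apply: cofib_factors; first exact: cov_left.
  by rewrite compBr compA (svalP (sec _)) comp1l comp1r subrr; exact: factors0.
- by move=> M; rewrite [LHS]stable_mapM (svalP (sec _)).
Qed.

End Stable.

(** * The quotient of the comma category *)

(** The injections and projections are kept as data, since diagonal morphisms are written with
    them. *)
Record biproduct (A : preadditive) (X Y : A) := Biproduct {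
  bip_ob : A;
  bip_i1 : hom X bip_ob;
  bip_i2 : hom Y bip_ob;
  bip_p1 : hom bip_ob X;
  bip_p2 : hom bip_ob Y;
  bipP : [/\ bip_p1 ∘ bip_i1 = idm X, bip_p2 ∘ bip_i2 = idm Y,
    bip_p1 ∘ bip_i2 = 0, bip_p2 ∘ bip_i1 = 0
    & bip_i1 ∘ bip_p1 + bip_i2 ∘ bip_p2 = idm bip_ob] }.

Lemma biproduct_ex (A : preadditive) (X Y : A) : abelian A -> inhabited (biproduct X Y).
Proof.
by move=> /sum_ob/(_ X Y)[B [i1 [i2 [p1 [p2 e]]]]]; split; exact: Biproduct e.
Qed.

Lemma sum_iso (A : preadditive) (X Y B B' : A) :
  is_direct_sum X Y B -> is_direct_sum X Y B' ->
  exists (f : hom B B') (g : hom B' B), g ∘ f = idm B /\ f ∘ g = idm B'.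
Proof.
move=> [i1 [i2 [p1 [p2 [p11 p22 p12 p21 ip]]]]] [j1 [j2 [q1 [q2 [q11 q22 q12 q21 jq]]]]].
exists (j1 ∘ p1 + j2 ∘ p2), (i1 ∘ q1 + i2 ∘ q2).
split; rewrite compDl !compDr !compA.
  rewrite !(compE _ q11) !(compE _ q22) !(compE _ q12) !(compE _ q21).
  by rewrite !comp0r !comp0l !comp1r addr0 add0r.
rewrite !(compE _ p11) !(compE _ p22) !(compE _ p12) !(compE _ p21).
by rewrite !comp0r !comp0l !comp1r addr0 add0r.
Qed.

(** * The core of the comma category and diagonal morphisms *)

Section CommaStable.
Variables (C D : preadditive) (abC : abelian C) (abD : abelian D).
Variables (projC : enough_projectives C) (projD : enough_projectives D).
Variables (G : additive_functor C D) (rG : right_exact G).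
Variables (U X : C -> Prop) (V Y : D -> Prop).
Hypotheses (UX : cotorsion U X) (VY : cotorsion V Y).
Hypothesis L1G_U : forall A H, U A -> is_L1 G A H -> is_zero H.
Hypothesis G_U : forall A, U A -> Y (G A).

Let XY : comma G -> Prop := comma_class (G := G) X Y.
Let L : comma G -> Prop := left_perp XY.

Let abG : abelian (comma G) := comma_abelian abC abD rG.
Let projG : enough_projectives (comma G) := comma_enough_projectives abC abD rG projC projD.

Lemma left_comma_ext1 (Z : comma G) : L Z <-> forall W, XY W -> ext1 Z W.
Proof. exact: (left_perpP abG projG). Qed.

Lemma comma_cot : cotorsion L XY.
Proof.
have -> : L = (fun Z => forall W, XY W -> ext1 Z W).
  by apply/funext => Z; apply/propext; exact: left_comma_ext1.
have [OC zOC] := zero_ob abC; have [OD zOD] := zero_ob abD.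
exact: (comma_cotorsion abC abD projC projD rG UX VY L1G_U G_U zOC zOD).
Qed.

Lemma left_comma_sumP (Z : comma G) : L Z <-> comma_sum_class (G := G) U V Z.
Proof.
have [OC zOC] := zero_ob abC; have [OD zOD] := zero_ob abD.
rewrite left_comma_ext1.
exact: (comma_leftP abC abD projC projD rG UX VY G_U zOC zOD).
Qed.

(** The right class is closed under direct summands, which yields the conditions on A and B;
    conversely (A, G A) is in the right class because G(U) lies in Y. *)
Lemma comma_omegaP (Z : comma G) : inter_class L XY Z <->
  comma_sum_class (G := G) (inter_class U X) (inter_class V Y) Z.
Proof.
split=> [[/left_comma_sumP[A [O [B [UA VB zO s]]]] XYZ]|[A [O [B [[UA XA] [VB YB] zO s]]]]].
  have /(right_sum comma_cot s)[[XA _] [_ YB]] := XYZ.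
  by exists A, O, B.
split; first by apply/left_comma_sumP; exists A, O, B.
apply/(right_sum comma_cot s); split; split=> //; first exact: G_U.
exact: (right_zero UX zO).
Qed.

(** Approximations of source and target assemble into (A, G A) + (0, B) -> Z. A morphism from a core
    object is determined by the source component on its first summand and the target component on
    its second, and each factors separately. *)
Lemma comma_omega_finite :
  contravariantly_finite (inter_class U X) -> contravariantly_finite (inter_class V Y) ->
  contravariantly_finite (inter_class L XY).
Proof.
move=> fC fD Z; have [OC zOC] := zero_ob abC.
have [A [a [oA la]]] := fC (comma_src Z); have [B [b [oB lb]]] := fD (comma_tgt Z).
have [W [i1 [i2 [p1 [p2 e]]]]] := sum_ob abD (G A) B.
have sW := diag_czero_sum zOC e; have [p11 p22 p12 p21 ip] := e.
pose M : comma G := CommaOb i1; pose d := comma_map Z ∘ amap G a ∘ p1 + b ∘ p2.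
have h : comma_map Z ∘ amap G a = d ∘ comma_map M.
  by rewrite compDl (compE _ p11) (compE _ p21) comp0r comp1r addr0.
exists M, (@comma_mk _ _ _ M Z _ _ h); split.
  by apply/comma_omegaP; exists A, OC, B.
move=> W' g /comma_omegaP[A' [O' [B' [oA' oB' zO' [j1 [j2 [q1 [q2 [_ _ _ _ jq]]]]]]]]].
have [a' ea] := la _ (hsrc (g ∘ j1)) oA'; have [b' eb] := lb _ (htgt (g ∘ j2)) oB'.
pose f : hom M Z := @comma_mk _ _ _ M Z _ _ h.
have e1 : f ∘ diag_hom (Z := M) a' = g ∘ j1 by exact: diag_hom_eq.
have e2 : f ∘ czero_hom O' (Z := M) (i2 ∘ b') = g ∘ j2.
  apply: (czero_hom_eq zO'); rewrite htgtM htgt_mk htgt_czero -eb compDl !compA.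
  by rewrite (compE _ p12) (compE _ p22) comp0r comp0l comp1r add0r.
exists (diag_hom (Z := M) a' ∘ q1 + czero_hom O' (Z := M) (i2 ∘ b') ∘ q2).
by rewrite -[RHS]comp1r -jq !compDr !compA -e1 -e2.
Qed.

Definition std_bip (A : C) (B : D) : biproduct (G A) B :=
  let: exist c _ := boolp.cid (P := fun _ : biproduct (G A) B => True)
    (let: inhabits c := biproduct_ex (G A) B abD in ex_intro _ c I) in c.

Definition std_ob (A : C) (B : D) : comma G := CommaOb (bip_i1 (std_bip A B)).

Lemma std_omega A B : inter_class U X A -> inter_class V Y B ->
  inter_class L XY (std_ob A B).
Proof.
move=> oA oB; have [OC zOC] := zero_ob abC; apply/comma_omegaP.
by exists A, OC, B; split=> //; exact: (diag_czero_sum zOC (bipP _)).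
Qed.

Lemma std_left A B : U A -> V B -> L (std_ob A B).
Proof.
move=> UA VB; have [OC zOC] := zero_ob abC; apply/left_comma_sumP.
by exists A, OC, B; split=> //; exact: (diag_czero_sum zOC (bipP _)).
Qed.

Lemma std_hom_subproof A B A' B' (u : hom A A') (v : hom B B') :
  bip_i1 (std_bip A' B') ∘ amap G u =
  (bip_i1 (std_bip A' B') ∘ amap G u ∘ bip_p1 (std_bip A B) +
   bip_i2 (std_bip A' B') ∘ v ∘ bip_p2 (std_bip A B)) ∘ bip_i1 (std_bip A B).
Proof.
case: (bipP (std_bip A B)) => p11 _ _ p21 _.
by rewrite compDl (compE _ p11) (compE _ p21) comp0r comp1r addr0.
Qed.

Definition std_hom A B A' B' (u : hom A A') (v : hom B B') : hom (std_ob A B) (std_ob A' B') :=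
  @comma_mk _ _ _ (std_ob A B) (std_ob A' B') u _ (std_hom_subproof u v).

Lemma std_hom1 A B : std_hom (idm A) (idm B) = idm (std_ob A B).
Proof.
apply: comma_eqP => //; rewrite htgt_mk amap1 !comp1r.
by case: (bipP (std_bip A B)).
Qed.

Lemma std_homM A1 B1 A2 B2 A3 B3 (u : hom A2 A3) (u' : hom A1 A2)
    (v : hom B2 B3) (v' : hom B1 B2) :
  std_hom (u ∘ u') (v ∘ v') = std_hom u v ∘ std_hom u' v'.
Proof.
apply: comma_eqP => //; rewrite htgtM !htgt_mk amapM.
case: (bipP (std_bip A2 B2)) => p11 p22 p12 p21 _.
rewrite compDl !compDr !compA !(compE _ p11) !(compE _ p12) !(compE _ p21) !(compE _ p22).
by rewrite !comp0r !comp0l !comp1r addr0 add0r.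
Qed.

Lemma std_homB A B A' B' (u u' : hom A A') (v v' : hom B B') :
  std_hom (u - u') (v - v') = std_hom u v - std_hom u' v'.
Proof.
apply: comma_eqP; first by rewrite hsrcB.
rewrite htgtB !htgt_mk amapD amapN !compBr !compBl opprD addrACA //.
Qed.

Lemma std_hom_factors A B A' B' (u : hom A A') (v : hom B B') :
  factors U X u -> factors V Y v -> factors L XY (std_hom u v).
Proof.
move=> [A0 [u1 [u2 [oA ->]]]] [B0 [v1 [v2 [oB ->]]]].
by exists (std_ob A0 B0), (std_hom u1 v1), (std_hom u2 v2); split;
  [exact: std_omega|exact: std_homM].
Qed.

(** Faithfulness. Sources give [u] at once. For [v], the middle object splits as (A0, G A0) + (0,
    Q), and [v] factors through [Q], which is in [V] and, as a summand of the target, in [Y]. *)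
Lemma factors_std_hom A B A' B' (u : hom A A') (v : hom B B') :
  factors L XY (std_hom u v) -> factors U X u /\ factors V Y v.
Proof.
move=> [W [s [t [[LW [XW YW]] e]]]].
have [OC zOC] := zero_ob abC; have [OD zOD] := zero_ob abD.
have [UW [Q [j [r [q [VQ eQ]]]]]] := comma_left_elim abC abD projD rG UX VY G_U zOC zOD
  (proj1 (left_comma_ext1 W) LW).
have [rf qj rj qf fr] := eQ; split.
  exists (comma_src W), (hsrc s), (hsrc t); split=> //; exact: (hsrc_eq e).
have YQ : Y Q.
  suff sQ : is_direct_sum (G (comma_src W)) Q (comma_tgt W) by case: (proj1 (right_sum VY sQ) YW).
  by exists (comma_map W), j, r, q.
have [p11 p22 p12 p21 ip] := bipP (std_bip A B).
have [p11' p22' p12' p21' ip'] := bipP (std_bip A' B').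
set i2 := bip_i2 _ in p22 p12 ip; set p2' := bip_p2 _ in p22' p21' ip'.
exists Q, (q ∘ htgt s ∘ i2), (p2' ∘ htgt t ∘ j); split=> //.
(* On the image of [comma_map W] the morphism [t] takes values in the summand [G A'], which [p2']
   kills. *)
have tf : p2' ∘ htgt t ∘ comma_map W = 0.
  rewrite -compA; apply: (etrans (congr1 (fun x => p2' ∘ x) (esym (comma_homP t)))).
  by rewrite compA p21' comp0l.
have -> : v = p2' ∘ (htgt t ∘ htgt s) ∘ i2.
  have et : _ = htgt t ∘ htgt s := htgt_eq e.
  rewrite -et htgt_mk compDr compDl !compA p21' p22' !comp0l add0r comp1l.
  by rewrite -compA p22 comp1r.
have fs : htgt s = comma_map W ∘ (r ∘ htgt s) + j ∘ (q ∘ htgt s).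
  by rewrite !compA -compDl fr comp1l.
by rewrite {1}fs !compDr compDl !compA tf !comp0l add0r.
Qed.

(** As a matrix on targets [h] is triangular: commutation with the structure maps kills the entry
    from [G A] to [B']. The one off-diagonal entry, from [B] in V to [G A'] in Y, factors through
    the core of [D]. *)
Lemma std_hom_full A B A' B' (h : hom (std_ob A B) (std_ob A' B')) : V B -> U A' ->
  exists (u : hom A A') (v : hom B B'), factors L XY (std_hom u v - h).
Proof.
move=> VB UA'; have [OC zOC] := zero_ob abC.
have [p11 p22 p12 p21 ip] := bipP (std_bip A B).
have [p11' p22' p12' p21' ip'] := bipP (std_bip A' B').
set i1 := bip_i1 _ in p11 p21 ip; set i2 := bip_i2 _ in p22 p12 ip.
set p1 := bip_p1 _ in p11 p12 ip; set p2 := bip_p2 _ in p22 p21 ip.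
set i1' := bip_i1 _ in p11' p21' ip'; set i2' := bip_i2 _ in p22' p12' ip'.
set p1' := bip_p1 _ in p11' p12' ip'; set p2' := bip_p2 _ in p22' p21' ip'.
exists (hsrc h), (p2' ∘ htgt h ∘ i2); rewrite -opprB; apply: factorsN.
have [W [s [t [[VW YW] st]]]] :=
  factors_left_right abD VY (p1' ∘ htgt h ∘ i2) VB (G_U UA').
have sp : (s ∘ p2) ∘ comma_map (std_ob A B) = 0 by rewrite -compA p21 comp0r.
(* Since [s ∘ p2] kills the summand [G A], the factorization passes through (0, W)_0, a core object
   of the comma category. *)
exists (comma_zero G OC W), (to_czero OC sp), (czero_hom OC (Z := std_ob A' B') (i1' ∘ t)).
split.
  split; first by apply/left_comma_ext1; exact: (left_czero abC abD projD rG VY zOC VW).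
  by split=> //; exact: (right_zero UX zOC).
apply: comma_eqP; first by rewrite hsrcB hsrcM !hsrc_mk subrr comp0l.
rewrite htgtB htgtM !htgt_mk; have hi := comma_homP h.
have hE : htgt h = i1' ∘ amap G (hsrc h) ∘ p1 + (i1' ∘ p1' + i2' ∘ p2') ∘ htgt h ∘ i2 ∘ p2.
  rewrite ip' comp1l -[LHS]comp1r -ip compDr !compA; congr (_ ∘ _ + _).
  by rewrite hi.
rewrite {1}hE !compDl !compA opprD addrACA subrr add0r addrK.
by rewrite -(compA i1' t) -st !compA.
Qed.

Let SC := stable_category abC UX.
Let SD := stable_category abD VY.
Let SG := stable_category abG comma_cot.

Definition std_stable (M : prod_category SC SD) : SG :=
  exist _ (std_ob (sval M.1) (sval M.2)) (std_left (svalP M.1) (svalP M.2)).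

Definition std_stable_map (M N : prod_category SC SD) (f : chom M N) :
    chom (std_stable M) (std_stable N) :=
  @stable_map _ abG _ _ comma_cot (std_stable M) (std_stable N) (std_hom (qrep f.1) (qrep f.2)).

Lemma std_stable_mapE (M N : prod_category SC SD)
    (u : hom (sval M.1) (sval N.1)) (v : hom (sval M.2) (sval N.2)) :
  @std_stable_map M N (stable_map abC UX u, stable_map abD VY v) =
  @stable_map _ abG _ _ comma_cot (std_stable M) (std_stable N) (std_hom u v).
Proof.
apply/stable_mapP; rewrite -std_homB; apply: std_hom_factors.
  by apply/(stable_mapP abC UX); exact: qrepK.
by apply/(stable_mapP abD VY); exact: qrepK.
Qed.

Lemma std_stable_map1 (M : prod_category SC SD) :
  std_stable_map (cid M) = cid (std_stable M).
Proof.
by rewrite [LHS]std_stable_mapE std_hom1.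
Qed.

Lemma std_stable_mapM (M N P : prod_category SC SD) (g : chom N P) (f : chom M N) :
  std_stable_map (ccomp g f) = ccomp (std_stable_map g) (std_stable_map f).
Proof.
case: g f => [g1 g2] [f1 f2].
have [a ->] := stable_mapE g1; have [b ->] := stable_mapE g2.
have [c ->] := stable_mapE f1; have [d ->] := stable_mapE f2.
have e : ccomp (c := prod_category SC SD) (stable_map abC UX a, stable_map abD VY b)
    (stable_map abC UX c, stable_map abD VY d) =
    (stable_map abC UX (a ∘ c), stable_map abD VY (b ∘ d)).
  by congr pair; exact: stable_mapM.
rewrite e [LHS]std_stable_mapE std_homM [std_stable_map (_, _)]std_stable_mapE.
rewrite [std_stable_map (stable_map _ _ c, _)]std_stable_mapE.
by rewrite [RHS]stable_mapM.
Qed.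

Definition std_stable_functor : functor (prod_category SC SD) SG :=
  @Functor (prod_category SC SD) SG std_stable std_stable_map std_stable_map1 std_stable_mapM.

Lemma stable_product : equivalent_categories (prod_category SC SD) SG.
Proof.
apply: (equivalent_of_functor (F := std_stable_functor)).
- move=> M N g; have [h ->] := stable_mapE g.
  have [u [v uv]] := std_hom_full h (svalP M.2) (svalP N.1).
  exists (stable_map abC UX u, stable_map abD VY v).
  by rewrite [LHS]std_stable_mapE; apply/stable_mapP.
- move=> M N [f1 f2] [g1 g2].
  have [a ->] := stable_mapE f1; have [b ->] := stable_mapE f2.
  have [c ->] := stable_mapE g1; have [d ->] := stable_mapE g2.
  move=> e; have {}e : std_stable_map (M := M) (N := N) (stable_map abC UX a, stable_map abD VY b) =
      std_stable_map (M := M) (N := N) (stable_map abC UX c, stable_map abD VY d) := e.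
  rewrite [LHS]std_stable_mapE [RHS]std_stable_mapE in e.
  move/stable_mapP: e; rewrite -std_homB => /factors_std_hom[fac fbd].
  by congr pair; apply/stable_mapP.
move=> [Z LZ]; have [OC zOC] := zero_ob abC; have [OD zOD] := zero_ob abD.
have [UZ [Q [j [r [q [VQ e]]]]]] := comma_left_elim abC abD projD rG UX VY G_U zOC zOD
  (proj1 (left_comma_ext1 Z) LZ).
pose M : prod_category SC SD := (exist _ _ UZ, exist _ _ VQ).
(* Essential surjectivity: [Z] and the standard object are direct sums of the same two summands. *)
have [f [g [gf fg]]] := sum_iso (diag_czero_sum zOC (bipP (std_bip (comma_src Z) Q)))
  (diag_czero_sum zOC e).
rewrite comma_eta in f g gf fg.
exists M, (@stable_map _ abG _ _ comma_cot (std_stable M) (exist _ Z LZ) f).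
exists (@stable_map _ abG _ _ comma_cot (exist _ Z LZ) (std_stable M) g).
by split; rewrite stable_mapM ?gf ?fg.
Qed.

Lemma Ho_comma : equivalent_categories (Ho (model_of_pair L XY))
  (prod_category (Ho (model_of_pair U X)) (Ho (model_of_pair V Y))).
Proof.
apply: equivalent_trans (Ho_stable abG comma_cot) _.
apply: equivalent_trans (equivalent_sym stable_product) _.
by apply: equivalent_prod; apply: equivalent_sym; exact: Ho_stable.
Qed.

End CommaStable.

Theorem theorem4p2 (C D : preadditive)
  (C_abelian : abelian C) (C_proj : enough_projectives C)
  (C_inj : enough_injectives C)
  (D_abelian : abelian D) (D_proj : enough_projectives D)
  (D_inj : enough_injectives D)
  (G : additive_functor C D) (G_right_exact : right_exact G)
  (U X : ob C -> Prop) (V Y : ob D -> Prop)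
  (UX : hereditary_complete_cotorsion_pair U X)
  (VY : hereditary_complete_cotorsion_pair V Y)
  (L1G_U : forall (A : ob C) (H : ob D), U A -> is_L1 G A H -> is_zero H)
  (G_U : forall A : ob C, U A -> Y (aob G A)) :
  let XY := comma_class (G := G) X Y in
  let UX0 := inter_class U X in
  let VY0 := inter_class V Y in
  let w := inter_class (left_perp XY) XY in
  [/\ hereditary_complete_cotorsion_pair (left_perp XY) XY,
      forall Z : ob (comma G), left_perp XY Z <-> comma_sum_class U V Z
    & contravariantly_finite UX0 -> contravariantly_finite VY0 ->
      [/\ forall Z : ob (comma G), w Z <-> comma_sum_class UX0 VY0 Z,
          contravariantly_finite w
        & equivalent_categories
            (Ho (model_of_pair (left_perp XY) XY))
            (prod_category (Ho (model_of_pair U X)) (Ho (model_of_pair V Y)))]].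
Proof.
move: UX VY => /(cotorsionP C_abelian C_proj) cUX /(cotorsionP D_abelian D_proj) cVY.
split=> [| |fC fD].
- apply/(cotorsionP (comma_abelian C_abelian D_abelian G_right_exact)
    (comma_enough_projectives C_abelian D_abelian G_right_exact C_proj D_proj)).
  exact: (comma_cot C_abelian D_abelian C_proj D_proj G_right_exact cUX cVY L1G_U G_U).
- exact: (left_comma_sumP C_abelian D_abelian C_proj D_proj G_right_exact cUX cVY G_U).
split.
- exact: (comma_omegaP C_abelian D_abelian C_proj D_proj G_right_exact cUX cVY L1G_U G_U).
- exact: (comma_omega_finite C_abelian D_abelian C_proj D_proj G_right_exact cUX cVY L1G_U G_U).
exact: (Ho_comma C_abelian D_abelian C_proj D_proj G_right_exact cUX cVY L1G_U G_U).
Qed.
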